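(* There exists a numerical constant $C>0$ such that the following holds. For all $A>0$, $B>0$, $\rho<-1$ and every $g_0\in\mathcal M^\rho_+([0,\infty))$, let $$f_0(\omega)=A\omega^{-1}\mathbf 1_{0<\omega<B}+\min\left(A\omega^{-1},\frac{g_0(\omega)}{\sqrt\omega}\right)\mathbf 1_{\omega>B}.$$ If $f$ is a non-negative weak solution of the wave kinetic equation $\partial_t f=Q(f)$ with initial data $f_0$, and $g(t,\omega)=\sqrt\omega f(t,\omega)$, then $$g(t,\{0\})>0\qquad\text{for all } t>CA^{-2}.$$
   Context: Measures and densities are written with the same notation: $\mu(\omega)$ denotes the (possibly formal) density of a measure $\mu$. For $\rho\in\mathbb R$, $\mathcal M^\rho_+([0,\infty))$ is the set of non-negative Radon measures $\mu$ on $[0,\infty)$ with $\|\mu\|_\rho<\infty$, where $$\|\mu\|_\rho=\sup_{R>1}\frac1{(1+R)^\rho}\frac1R\int_{R/2}^R\mu(d\omega)+\int_0^1\mu(d\omega).$$ The formula for $f_0$ is understood through the measure $g_{\rm in}=\sqrt\omega f_0$: it equals $A\omega^{-1/2}d\omega$ on $(0,B)$, it equals the minimum (in the lattice of measures) of $A\omega^{-1/2}d\omega$ and $g_0$ on $(B,\infty)$, and it gives no mass to $\{0\}$ and $\{B\}$. The wave kinetic equation is $\partial_t f=Q(f)$ with $$Q(f)(\omega_1)=\iint_{D(\omega_1)}W\,[(f_1+f_2)f_3f_4-(f_3+f_4)f_1f_2]\,d\omega_3d\omega_4,\qquad W=\frac{\min\{\sqrt{\omega_1},\sqrt{\omega_2},\sqrt{\omega_3},\sqrt{\omega_4}\}}{\sqrt{\omega_1}},$$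 where $f_i=f(\omega_i)$, $\omega_2=\omega_3+\omega_4-\omega_1$ and $D(\omega_1)=\{\omega_3>0,\ \omega_4>0,\ \omega_3+\omega_4>\omega_1\}$. Weak solution: let $f_0$ be a non-negative measure such that $g_{\rm in}=\sqrt\omega f_0\in\mathcal M^\rho_+([0,\infty))$ for some $\rho<-1$. A family of measures $f(t,\cdot)$, $t>0$, is a weak solution with initial data $f_0$ if $g(t,\omega)=\sqrt\omega f(t,\omega)$ satisfies: 1. $g\in C([0,\infty);\mathcal M^\rho_+([0,\infty)))$ (continuity with respect to $\|\cdot\|_\rho$, applied to the total variation of differences). 2. For all $\varphi\in C_0^2([0,\infty)\times[0,\infty))$ and all $t_*>0$, $$\int_{[0,\infty)}g(t_*,\omega)\varphi(t_*,\omega)d\omega-\int_{[0,\infty)}g_{\rm in}(\omega)\varphi(0,\omega)d\omega=\int_0^{t_*}\int_{[0,\infty)}g\,\partial_t\varphi\,d\omega dt$$ $$+\int_0^{t_*}\iiint_{[0,\infty)^3}\frac{g_1g_2g_3\Phi}{\sqrt{\omega_1\omega_2\omega_3}}\,[\varphi(\omega_1+\omega_2-\omega_3)+\varphi(\omega_3)-\varphi(\omega_1)-\varphi(\omega_2)]\,d\omega_1d\omega_2d\omega_3dt,$$ where $g_i=g(t,\omega_i)$, the time argument of $\varphi$ in the last bracket is $t$, $\Phi=\min\{\sqrt{\omega_1},\sqrt{\omega_2},\sqrt{\omega_3},\sqrt{\omega_4}\}$ and $\omega_4=(\omega_1+\omega_2-\omega_3)_+$ (so the integrand vanishes when $\omega_1+\omega_2<\omega_3$);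 the factor multiplying $g_1g_2g_3$ is extended by continuity to points where some $\omega_i=0$. 3. For all $t>0$, $\int_{[0,\infty)}g(t,\omega)d\omega=\int_{[0,\infty)}g_{\rm in}(\omega)d\omega$ and $\int_{[0,\infty)}g(t,\omega)\omega\,d\omega=\int_{[0,\infty)}g_{\rm in}(\omega)\omega\,d\omega$ (conservation of mass and energy). *)

(* Defs.v *)
From HB Require Import structures.
From mathcomp Require Import all_boot all_order all_algebra.
From mathcomp Require Import all_classical all_reals all_analysis measurable_realfun.

Set Implicit Arguments.
Unset Strict Implicit.
Unset Printing Implicit Defensive.
Import Order.TTheory GRing.Theory Num.Theory.
Import numFieldNormedType.Exports.

Local Open Scope classical_set_scope.
Local Open Scope ring_scope.

Section measure_with_density.
Local Open Scope ereal_scope.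
Context d (T : measurableType d) (R : realType).
Variables (mu : {measure set T -> \bar R}) (f : T -> \bar R).
Hypotheses (f_ge0 : forall x, 0 <= f x) (mf : measurable_fun [set: T] f).

Definition mdensity of (forall x, 0 <= f x) & measurable_fun [set: T] f :=
  fun E : set T => \int[mu]_(x in E) f x.

Local Notation mdens := (mdensity f_ge0 mf).

Let mdens0 : mdens set0 = 0.
Proof. by rewrite /mdensity integral_set0. Qed.

Let mdens_ge0 E : 0 <= mdens E.
Proof. by rewrite /mdensity; apply: integral_ge0 => x _. Qed.

Let mdens_sigma_additive : semi_sigma_additive mdens.
Proof.
move=> F mF tF mUF; rewrite /mdensity ge0_integral_bigcup//; last first.
  exact: measurable_funTS.
by apply: is_cvg_ereal_nneg_natsum => n _; exact: integral_ge0.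
Qed.

HB.instance Definition _ := isMeasure.Build d T R mdens
  mdens0 mdens_ge0 mdens_sigma_additive.

End measure_with_density.

Section lattice_minimum.
Local Open Scope ereal_scope.
Context d (T : measurableType d) (R : realType).
Variables m1 m2 : {measure set T -> \bar R}.

(* The infimum of two measures in the lattice of measures; see [meas_min_lel],
   [meas_min_ler] and [meas_min_greatest]. *)
Definition meas_min (E : set T) : \bar R :=
  ereal_inf [set m1 F + m2 (E `\` F) | F in
             [set F | measurable F /\ F `<=` E]].

Let meas_min_ge0 E : 0 <= meas_min E.
Proof. by apply: le_ereal_inf_tmp => _ [F _ <-]; rewrite adde_ge0. Qed.

Let meas_min0 : meas_min set0 = 0.
Proof.
apply/eqP; rewrite eq_le meas_min_ge0 andbT; apply: ereal_inf_lbound.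
by exists set0; [split|rewrite setD0 !measure0 adde0].
Qed.

Let meas_min_sigma_additive : semi_sigma_additive meas_min.
Proof.
move=> F mF tF mUF.
suff -> : meas_min (\bigcup_n F n) = \sum_(0 <= i <oo) meas_min (F i).
  by apply: is_cvg_ereal_nneg_natsum => n _.
apply/eqP; rewrite eq_le; apply/andP; split.
- apply/lee_addgt0Pr => e e0.
  have e2 n : (0 < e / (2 ^ n.+1)%:R)%R by rewrite divr_gt0// ltr0n expn_gt0.
  have /choice[G HG] n : exists G, [/\ measurable G, G `<=` F n &
      m1 G + m2 (F n `\` G) <= meas_min (F n) + (e / (2 ^ n.+1)%:R)%:E].
    have [mn|mn] := boolP (meas_min (F n) \is a fin_num).
      have [_ [G [mG GF] <-] /ltW ?] := lb_ereal_inf_adherent (e2 n) mn.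
      by exists G.
    exists set0; split => //.
    move: mn; rewrite ge0_fin_numE// -leNgt leye_eq => /eqP ->.
    by rewrite addye// leey.
  have mG n : measurable (G n) by case: (HG n).
  have GF n : G n `<=` F n by case: (HG n).
  have tG : trivIset setT G.
    apply/trivIsetP => i j _ _ ij; apply/seteqP; split => // x [Gi Gj].
    by move/trivIsetP : tF => /(_ i j Logic.I Logic.I ij) <-; split; exact: GF.
  have tD : trivIset setT (fun n => F n `\` G n).
    apply/trivIsetP => i j _ _ ij; apply/seteqP; split => // x [[Fi _] [Fj _]].
    by move/trivIsetP : tF => /(_ i j Logic.I Logic.I ij) <-; split.
  apply: (@le_trans _ _ (m1 (\bigcup_n G n) +
                         m2 (\bigcup_n F n `\` \bigcup_n G n))).
    apply: ereal_inf_lbound; exists (\bigcup_n G n) => //; split.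
      exact: bigcup_measurable.
    exact: subset_bigcup.
  have -> : \bigcup_n F n `\` \bigcup_n G n = \bigcup_n (F n `\` G n).
    apply/seteqP; split => x.
      by move=> [[n _ Fn] nG]; exists n => //; split => // Gn; apply: nG; exists n.
    move=> [n _ [Fn nGn]]; split; first by exists n.
    move=> [k _ Gk]; apply: nGn; have [<-//|kn] := eqVneq k n.
    exfalso; move/trivIsetP : tF => /(_ k n Logic.I Logic.I kn) /seteqP[+ _].
    by move=> /(_ x); apply; split => //; exact: GF.
  rewrite !measure_bigcup//; last by move=> n _; exact: measurableD.
  rewrite [X in X + _](_ : _ = \sum_(0 <= i <oo) m1 (G i)); last first.
    by apply: eq_eseriesl => i; rewrite in_setT.
  rewrite [X in _ + X](_ : _ = \sum_(0 <= i <oo) m2 (F i `\` G i)); last first.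
    by apply: eq_eseriesl => i; rewrite in_setT.
  rewrite -nneseriesD//.
  apply: le_trans (epsilon_trick xpredT _ (ltW e0)) => //.
  by apply: lee_nneseries => [n _|n _]; [rewrite adde_ge0|case: (HG n)].
- apply: le_ereal_inf_tmp => _ [G [mG GF] <-].
  have -> : G = \bigcup_n (G `&` F n).
    by rewrite -setI_bigcupr; apply/seteqP; split => x; [move=> Gx; split => //; exact: GF|case].
  have -> : \bigcup_n F n `\` \bigcup_n (G `&` F n) = \bigcup_n (F n `\` (G `&` F n)).
    rewrite -setI_bigcupr setDIr setDv setU0 setD_bigcupl.
    by apply: eq_bigcupr => n _; rewrite setDIr setDv setU0.
  rewrite !measure_bigcup//; first last.
  - apply/trivIsetP => i j _ _ ij; apply/seteqP; split => // x [[_ Fi] [_ Fj]].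
    by move/trivIsetP : tF => /(_ i j Logic.I Logic.I ij) <-; split.
  - by move=> n _; exact: measurableI.
  - apply/trivIsetP => i j _ _ ij; apply/seteqP; split => // x [[Fi _] [Fj _]].
    by move/trivIsetP : tF => /(_ i j Logic.I Logic.I ij) <-; split.
  - by move=> n _; apply: measurableD => //; exact: measurableI.
  rewrite [X in _ <= X + _](_ : _ = \sum_(0 <= i <oo) m1 (G `&` F i)); last first.
    by apply: eq_eseriesl => i; rewrite in_setT.
  rewrite [X in _ <= _ + X](_ : _ = \sum_(0 <= i <oo) m2 (F i `\` (G `&` F i))); last first.
    by apply: eq_eseriesl => i; rewrite in_setT.
  rewrite -nneseriesD//; apply: lee_nneseries => // n _.
  apply: ereal_inf_lbound; exists (G `&` F n) => //; split => //.
  exact: measurableI.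
Qed.

HB.instance Definition _ := isMeasure.Build d T R meas_min
  meas_min0 meas_min_ge0 meas_min_sigma_additive.

Lemma meas_min_lel E : measurable E -> meas_min E <= m1 E.
Proof.
move=> mE; apply: ereal_inf_lbound; exists E; first by split.
by rewrite setDv measure0 adde0.
Qed.

Lemma meas_min_ler E : meas_min E <= m2 E.
Proof.
apply: ereal_inf_lbound; exists set0; first by split.
by rewrite setD0 measure0 add0e.
Qed.

Lemma meas_min_greatest (m : {measure set T -> \bar R}) :
  (forall E, measurable E -> m E <= m1 E) ->
  (forall E, measurable E -> m E <= m2 E) ->
  forall E, measurable E -> m E <= meas_min E.
Proof.
move=> mm1 mm2 E mE; apply: le_ereal_inf_tmp => _ [F [mF FE] <-].
have mEF : measurable (E `\` F) by exact: measurableD.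
rewrite -[in m E](setDUK FE) measureU//; first by rewrite leeD ?mm1 ?mm2.
by rewrite setIDA setIC -setIDA setDv setI0.
Qed.

End lattice_minimum.

Section wave_kinetic.
Variable R : realType.

(* A measure on [0, +oo) is a Borel measure on the line that does not charge
   the negative half-line (see [in_M]). *)
Local Notation msr := {measure set (measurableTypeR R) -> \bar R}.
Local Notation leb := (@lebesgue_measure R).
Local Notation half_line := (`[0, +oo[%classic : set R).

(* The norm only sees the values on intervals, so it is defined for an
   arbitrary set function; it is applied to measures and to [tvar]. *)
Definition Mnorm (rho : R) (m : set R -> \bar R) : \bar R :=
  (ereal_sup [set ((1 + r) `^ rho)^-1%:E * (r^-1%:E * m `[(r / 2)%R, r]%classic)
             | r in [set r : R | (1 < r)%R]]
   + m `[0%R, 1%R]%classic)%E.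

(* On the line every locally finite Borel measure is regular, hence Radon. *)
Definition in_M (rho : R) (m : msr) : Prop :=
  [/\ m `]-oo, 0[%classic = 0%E,
      forall K : set R, compact K -> (m K < +oo)%E &
      (Mnorm rho m < +oo)%E].

(* total variation of [m1 - m2] on [E], by finite measurable partitions *)
Definition tvar (m1 m2 : msr) (E : set R) : \bar R :=
  ereal_sup [set v | exists n (F : 'I_n -> set (measurableTypeR R)),
    [/\ forall k, measurable (F k), trivIset setT F, \bigcup_k F k = E &
        v = (\sum_(k < n) `|m1 (F k) - m2 (F k)|)%E]].

(* [ut] and [uw] are the partial derivatives of [u], in the interior of the
   closed quadrant, and all three are continuous up to its boundary.  Points
   are pairs (t, w). *)
Definition quadrant : set (R * R) := [set p | 0 <= p.1 /\ 0 <= p.2].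

Definition C1_quadrant (u ut uw : R * R -> R) : Prop :=
  [/\ {within quadrant, continuous u},
      {within quadrant, continuous ut},
      {within quadrant, continuous uw} &
      forall p : R * R, 0 < p.1 -> 0 < p.2 ->
        is_derive p ((1, 0) : R * R) u (ut p) /\
        is_derive p ((0, 1) : R * R) u (uw p)].

(* [phi] is a compactly supported C^2 function on the closed quadrant and
   [phit] is its time derivative; the values outside the quadrant are
   irrelevant. *)
Definition test_function (phi phit : R * R -> R) : Prop :=
  (exists phiw phitt phitw phiwt phiww : R * R -> R,
     [/\ C1_quadrant phi phit phiw,
         C1_quadrant phit phitt phitw &
         C1_quadrant phiw phiwt phiww]) /\
  (exists M : R, forall p, quadrant p -> M < p.1 \/ M < p.2 -> phi p = 0).

Definition octant : set (R * R * R) :=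
  [set w | [/\ 0 < w.1.1, 0 < w.1.2 & 0 < w.2]].

Definition Phi (w : R * R * R) : R :=
  let w4 := Num.max (w.1.1 + w.1.2 - w.2) 0 in
  Num.min (Num.sqrt w.1.1)
    (Num.min (Num.sqrt w.1.2) (Num.min (Num.sqrt w.2) (Num.sqrt w4))).

(* Where w1 + w2 < w3 the value of [psi] at a negative argument is multiplied
   by [Phi w = 0]. *)
Definition collision_factor_open (psi : R -> R) (w : R * R * R) : R :=
  Phi w / Num.sqrt (w.1.1 * w.1.2 * w.2) *
  (psi (w.1.1 + w.1.2 - w.2) + psi w.2 - psi w.1.1 - psi w.1.2).

(* extension by continuity to the boundary of the octant *)
Definition collision_factor (psi : R -> R) (w : R * R * R) : R :=
  if w \in octant then collision_factor_open psi w
  else lim (collision_factor_open psi @ within octant (nbhs w)).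

(* The solution is carried by the measures [g t] = sqrt w f(t, w): the measure
   f(t, .) itself is only formal, since [g t] may charge {0}. The integrands
   of the triple integral are bounded and the measures finite, so that it is
   written as an iterated integral. *)
Record weak_solution_in (rho : R) (g_in : msr) (g : R -> msr) : Prop := {
  ws_initial_in_M : in_M rho g_in ;
  ws_in_M : forall t, 0 <= t -> in_M rho (g t) ;
  ws_continuous : forall s, 0 <= s ->
    Mnorm rho (tvar (g t) (g s)) @[t --> within half_line (nbhs s)] --> 0%E ;
  ws_equation : forall (phi phit : R * R -> R) (T : R),
    test_function phi phit -> 0 < T ->
    \int[g T]_(w in half_line) phi (T, w)
      - \int[g_in]_(w in half_line) phi (0, w)
    = \int[leb]_(t in `[0, T]%classic)
        \int[g t]_(w in half_line) phit (t, w)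
      + \int[leb]_(t in `[0, T]%classic)
        \int[g t]_(w1 in half_line)
          \int[g t]_(w2 in half_line)
            \int[g t]_(w3 in half_line)
              collision_factor (fun w => phi (t, w)) (w1, w2, w3) ;
  ws_mass : forall t, 0 < t -> g t half_line = g_in half_line ;
  ws_energy : forall t, 0 < t ->
    (\int[g t]_(w in half_line) w%:E = \int[g_in]_(w in half_line) w%:E)%E
}.

Definition weak_solution (g_in : msr) (g : R -> msr) : Prop :=
  exists2 rho : R, rho < -1 & weak_solution_in rho g_in g.

Section initial_datum.
Variables (A : R) (A_gt0 : 0 < A) (B : R) (g0 : msr).

Let dens (w : measurableTypeR R) : \bar R := (A * w `^ (- 2^-1))%:E.

Let dens_ge0 w : (0 <= dens w)%E.
Proof. by rewrite lee_fin mulr_ge0 ?powR_ge0// ltW. Qed.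

Let measurable_dens : measurable_fun setT dens.
Proof.
apply/measurable_EFinP; exact: measurable_funM.
Qed.

(* the measure A w^(-1/2) dw, to be restricted to w > 0 *)
Definition RJ_measure : msr := mdensity leb dens_ge0 measurable_dens.

(* the measure sqrt w f_0 *)
Definition g_initial : msr := measure_add
  (mrestr RJ_measure (measurable_itv `]0, B[))
  (mrestr (meas_min RJ_measure g0) (measurable_itv `]B, +oo[)).

End initial_datum.

End wave_kinetic.

(* Main.v *)
Require Import Defs.
From mathcomp Require Import all_boot all_order all_algebra.
From mathcomp Require Import all_classical all_reals all_analysis.
From mathcomp Require Import measurable_realfun ring lra.
Import Order.TTheory GRing.Theory Num.Theory.
Import numFieldNormedType.Exports.
Local Open Scope classical_set_scope.
Local Open Scope ring_scope.

(** Why a condensate forms.  The equation is tested against convex profiles psi of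
    the frequency alone.  When the trilinear collision term is symmetrised over
    which of its frequencies is w3, frequencies a <= b <= c contribute a nonnegative
    term plus
      (b c)^(-1/2) (psi (c + (b - a)) + psi (c - (b - a)) - 2 psi c),
    which is nonnegative by convexity [cyclic_sum_ge0].  Hence the integral of psi
    against g(t) never decreases [profile_integral_nd].  Applied to the cubic profiles
    ((1 - w/r)_+)^3 this says that mass near the origin stays there: the mass of
    [0, x] is at most 8 times the mass of [0, 2x] at any later time
    [mass_le_later], and the initial lower bound of order A r^(1/2) on the mass
    below r persists [small_scale_mass].

    Suppose that there is no condensate at time t.  By the first statement there is
    none before, and the mass below a small scale is small uniformly before t.  At a
    scale r the triples with a in (0, r/8] and b, c in (r/4, r] make the integral of
    the cubic profile increase at a rate of order
      r^(-1) (mass of (0, r/8]) (mass of (r/4, r])^2,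
    so at least of order A r^(-1/2) x_r^2, where x_r is the mass of (r/4, r]
    [triple_integral_superposition_ge].  Let X be the integral of the superposition of
    the cubic profiles at the scales B 4^(-k) with weights (3/4)^k.  The weights are
    summable, so X is at most a multiple of the mass of [0, B]; but in the growth
    rate of X the square x_k^2 comes with the factor A B^(-1/2) (3/2)^k, and by the
    Cauchy-Schwarz inequality [weighted_square] the rate is at least of order
    A B^(-1/2) (x_0 + x_1 + ...)^2.  In the absence of a condensate the sum is the
    mass of [0, B], up to the negligible small scales.  So X' >= c A B^(-1/2) X^2,
    with an initial value of order A B^(1/2): X blows up within a time of order
    A^(-2), which B does not enter, whereas the total mass is finite
    [condensation_contradiction].

    Two points need care.  On the boundary of the octant the collision factor is
    defined as a limit.  The limit exists because the bracket of a C^2 profile is a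
    mixed second difference [mixed_difference], small enough to absorb the
    singularity of the kernel [collision_factor_cvg]; measurability and the sign of
    the symmetrised factor then pass from the interior to the boundary.  And the
    growth rate is not known to be measurable in time, so only the monotonicity of
    the integral is used: the differential inequality is replaced by a count of
    doubling times. *)

Set Implicit Arguments.
Unset Strict Implicit.
Unset Printing Implicit Defensive.

(** * Convex profiles and their mixed second differences *)

Section convex_profiles.
Variable R : realType.
Implicit Types (psi : R -> R) (r L N x y z d : R).

(** With exponent 3 this is the simplest C^2 function that is convex and vanishes
    on a half-line; every cutoff below is built from it. *)
Definition pospart_exp (n : nat) (x : R) : R := Num.max x 0 ^+ n.

Lemma is_derive_pospart_exp (n : nat) (x : R) :
  is_derive x 1 (pospart_exp n.+2) (n.+2%:R * pospart_exp n.+1 x).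
Proof.
have [x0|x0|->] := ltgtP x 0.
- apply: (@near_eq_is_derive _ _ _ (cst 0)).
    near=> y; rewrite /pospart_exp max_r ?expr0n//.
    by apply: ltW; near: y; exact: lt_nbhsl.
  apply: is_derive_eq.
  by rewrite /pospart_exp max_r ?expr0n ?mulr0//; exact: ltW.
- apply: (@near_eq_is_derive _ _ _ (fun y : R => y ^+ n.+2)).
    near=> y; rewrite /pospart_exp max_l//.
    by apply: ltW; near: y; exact: lt_nbhsr.
  have := is_deriveX n.+2 (is_derive_id x 1); rewrite exprfctE => dX.
  by apply: (is_derive_eq dX); rewrite /pospart_exp max_l ?(ltW x0)//= [_ *: _]mulr1.
- have E : (h^-1 *: ((pospart_exp n.+2 \o shift 0) (h *: 1) - pospart_exp n.+2 0))
      @[h --> (0:R)^'] --> (0:R).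
    apply: (@cvg_to_0_linear _ _ 1 1) => // h /andP[h0 h1].
    rewrite /pospart_exp/= maxxx expr0n subr0 addr0 [h *: 1]mulr1 mul1r.
    rewrite [X in `|X|](_ : _ = h^-1 * Num.max h 0 ^+ n.+2)//.
    rewrite normrM normfV normrX.
    have hm : `|Num.max h 0| <= `|h|.
      by case: (leP h 0) => h2; rewrite ?normr0.
    rewrite ler_pdivrMl// exprS ler_pM//.
    rewrite exprS -[leRHS]mulr1 ler_pM// exprn_ile1//.
    exact: le_trans (ltW h1).
  split; first by apply/cvg_ex; exists 0.
  by rewrite /pospart_exp maxxx expr0n mulr0; apply: cvg_lim.
Unshelve. all: by end_near. Qed.

Lemma continuous_pospart_exp (n : nat) : continuous (pospart_exp n).
Proof.
move=> x; apply: (@cvg_comp _ _ _ _ (fun y : R => y ^+ n)); last exact: exprn_continuous.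
by apply: (@continuous_max _ _ (fun y : R => y) (fun _ => 0)); [exact: cvg_id|exact: cvg_cst].
Qed.

Lemma derive_continuous (f f' : R -> R) :
  (forall x, is_derive x 1 f (f' x)) -> continuous f.
Proof.
by move=> df x; apply/differentiable_continuous/derivable1_diffP; case: (df x).
Qed.

(** The bounds [cp_convex] and [cp_bound] are asked on the half-line only: the
    cubic profiles are unbounded at minus infinity, where no frequency lies. *)
Record convex_profile (psi psi1 psi2 : R -> R) (r L N : R) : Prop := {
  cp_derive : forall x, is_derive x 1 psi (psi1 x) ;
  cp_derive2 : forall x, is_derive x 1 psi1 (psi2 x) ;
  cp_continuous2 : continuous psi2 ;
  cp_convex : forall x, 0 <= x -> 0 <= psi2 x <= L ;
  cp_bound : forall x, 0 <= x -> 0 <= psi x <= N ;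
  cp_support : forall x, r <= x -> psi x = 0 }.

Lemma MVT_between (f f' : R -> R) (a b : R) :
  (forall x, is_derive x 1 f (f' x)) ->
  exists2 c, Num.min a b <= c <= Num.max a b & f b - f a = f' c * (b - a).
Proof.
move=> df; have cf := derive_continuous df.
have [ab|ba] := leP a b.
  have [|c] := @MVT_segment _ f f' _ _ ab (fun y _ => df y).
    exact: continuous_subspaceT.
  by rewrite in_itv/=; exists c.
have [|c] := @MVT_segment _ f f' _ _ (ltW ba) (fun y _ => df y).
  exact: continuous_subspaceT.
rewrite in_itv/= => cab E; exists c => //.
by rewrite -opprB E -mulrN opprB.
Qed.

(** The gain minus the loss of a collision is a mixed second difference, and two
    uses of the mean value theorem turn it into a second derivative.  This one
    identity yields both the sign of the bracket, by convexity, and its size near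
    the boundary of the octant. *)
Lemma mixed_difference (f f' f'' : R -> R) x y z :
  (forall x, is_derive x 1 f (f' x)) -> (forall x, is_derive x 1 f' (f'' x)) ->
  0 <= x -> 0 <= y -> 0 <= z -> 0 <= x + y - z ->
  exists2 c, 0 <= c &
    f (x + y - z) + f z - f x - f y = f'' c * (x - z) * (y - z).
Proof.
move=> df df' x0 y0 z0 w0.
have dh (u : R) : is_derive u 1 (fun v => f (v + (y - z)) - f v) (f' (u + (y - z)) - f' u).
  have d1 : is_derive u 1 (f \o shift (y - z)) (f' (u + (y - z)) * 1).
    by apply: is_derive1_comp => //; exact: is_derive_shift.
  rewrite mulr1 in d1.
  exact: is_deriveB.
have [b bxz E1] := MVT_between z x dh.
have [c cb E2] := MVT_between b (b + (y - z)) df'.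
exists c.
  have b0 : 0 <= b.
    by case/andP: bxz => + _; apply: le_trans; rewrite le_min z0.
  have b1 : 0 <= b + (y - z).
    case/andP: bxz; case: (leP z x) => zx ? ?; lra.
  by case/andP: cb => + _; apply: le_trans; rewrite le_min b0.
have -> : x + y - z = x + (y - z) by rewrite addrA.
have zy : z + (y - z) = y by ring.
have by_ : b + (y - z) - b = y - z by ring.
rewrite E2 by_ zy /= in E1.
by rewrite mulrAC -E1; ring.
Qed.

End convex_profiles.

(** * Bounds on the collision factor inside the octant *)

Section collision.
Variable R : realType.
Variables (psi psi1 psi2 : R -> R) (r L N : R).
Hypothesis psiP : convex_profile psi psi1 psi2 r L N.
Implicit Types (x y z u v : R) (w : R * R * R).

Definition gain_loss w : R :=
  psi (w.1.1 + w.1.2 - w.2) + psi w.2 - psi w.1.1 - psi w.1.2.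

Definition rate w : R := Phi w / Num.sqrt (w.1.1 * w.1.2 * w.2).

Lemma collision_factor_openE w :
  collision_factor_open psi w = rate w * gain_loss w.
Proof. by []. Qed.

Lemma Phi_ge0 w : 0 <= Phi w.
Proof. by rewrite /Phi !le_min !sqrtr_ge0. Qed.

Lemma Phi_eq0 w : w.1.1 + w.1.2 <= w.2 -> Phi w = 0.
Proof.
move=> h; apply/eqP; rewrite eq_le Phi_ge0 andbT /Phi max_r ?subr_le0//.
by rewrite sqrtr0 !ge_min lexx !orbT.
Qed.

Lemma rate_ge0 w : 0 <= rate w.
Proof. by rewrite divr_ge0 ?Phi_ge0 ?sqrtr_ge0. Qed.

Lemma rate_le w (u v t : R) : 0 < u -> 0 < v -> 0 < t ->
  t * (u * v) = w.1.1 * w.1.2 * w.2 -> Phi w <= Num.sqrt t ->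
  rate w <= (Num.sqrt (u * v))^-1.
Proof.
move=> u0 v0 t0 tE Pt.
rewrite /rate -tE sqrtrM ?(ltW t0)// invfM mulrA ler_piMl ?invr_ge0 ?sqrtr_ge0//.
by rewrite ler_pdivrMr ?sqrtr_gt0// mul1r.
Qed.

(** [Phi] is at most the square root of each frequency, which cancels one of the
    three factors of the denominator. *)
Lemma rate_le_pairs w : octant w ->
  [/\ rate w <= (Num.sqrt (w.1.1 * w.1.2))^-1,
      rate w <= (Num.sqrt (w.1.2 * w.2))^-1 &
      rate w <= (Num.sqrt (w.1.1 * w.2))^-1].
Proof.
case=> x0 y0 z0; split.
- by apply: (rate_le x0 y0 z0); [ring|rewrite /Phi !ge_min lexx !orbT].
- by apply: (rate_le y0 z0 x0); [ring|rewrite /Phi !ge_min lexx].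
- by apply: (rate_le x0 z0 y0); [ring|rewrite /Phi !ge_min lexx !orbT].
Qed.

Lemma gain_loss_bound w : octant w -> 0 <= w.1.1 + w.1.2 - w.2 ->
  `|gain_loss w| <= L * (`|w.1.1 - w.2| * `|w.1.2 - w.2|).
Proof.
case=> /ltW x0 /ltW y0 /ltW z0 w0.
have [c c0 E] := mixed_difference (cp_derive psiP) (cp_derive2 psiP) x0 y0 z0 w0.
rewrite /gain_loss E !normrM -mulrA ler_wpM2r ?mulr_ge0//.
by have /andP[h1 h2] := cp_convex psiP c0; rewrite ger0_norm.
Qed.

Lemma profile_curvature_ge0 : 0 <= L.
Proof. by have /andP[a b] := cp_convex psiP (lexx 0); exact: le_trans b. Qed.

Lemma profile_bound_ge0 : 0 <= N.
Proof. by have /andP[a b] := cp_bound psiP (lexx 0); exact: le_trans b. Qed.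

(** The second elementary symmetric function: on the closed octant it vanishes
    exactly where two of the frequencies do, and there the limit of the factor is
    zero. *)
Definition pair_sum w := w.1.1 * w.1.2 + w.1.2 * w.2 + w.1.1 * w.2.

(** The rate is singular like (u v)^(-1/2) for any two frequencies u, v, while the
    bracket is at most L |w1 - w3| |w2 - w3|, itself at most L u v for a suitable
    choice of u and v that depends on the position of w3. *)
Lemma collision_factor_open_small w : octant w ->
  `|collision_factor_open psi w| <= L * Num.sqrt (pair_sum w).
Proof.
move=> ow; have [K1 K2 K3] := rate_le_pairs ow; have [x0 y0 z0] := ow.
rewrite collision_factor_openE.
have [h|h] := leP (w.1.1 + w.1.2) w.2.
  by rewrite /rate Phi_eq0// !mul0r normr0 mulr_ge0 ?profile_curvature_ge0 ?sqrtr_ge0.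
have w0 : 0 <= w.1.1 + w.1.2 - w.2 by rewrite subr_ge0 ltW.
rewrite normrM ger0_norm ?rate_ge0//.
apply: (@le_trans _ _ (rate w * (L * (`|w.1.1 - w.2| * `|w.1.2 - w.2|)))).
  by rewrite ler_wpM2l ?rate_ge0 ?gain_loss_bound.
rewrite mulrCA ler_wpM2l ?profile_curvature_ge0//.
have key u v : 0 < u -> 0 < v -> rate w <= (Num.sqrt (u * v))^-1 ->
    u * v <= pair_sum w -> `|w.1.1 - w.2| * `|w.1.2 - w.2| <= u * v ->
    rate w * (`|w.1.1 - w.2| * `|w.1.2 - w.2|) <= Num.sqrt (pair_sum w).
  move=> u0 v0 Kuv uvs duv.
  have uv0 : 0 < u * v by rewrite mulr_gt0.
  apply: (@le_trans _ _ ((Num.sqrt (u * v))^-1 * (u * v))).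
    by rewrite ler_pM ?rate_ge0 ?mulr_ge0.
  rewrite -{2}(sqr_sqrtr (ltW uv0)) expr2 mulrA mulVf ?mul1r ?gt_eqF ?sqrtr_gt0//.
  by rewrite ler_wsqrtr.
have xy0 := mulr_gt0 x0 y0; have yz0 := mulr_gt0 y0 z0; have xz0 := mulr_gt0 x0 z0.
have [xz|zx] := leP w.1.1 w.2; have [yz|zy] := leP w.1.2 w.2.
- apply: (key w.1.1 w.1.2) => //; first by rewrite /pair_sum; lra.
  rewrite mulrC !ler0_norm ?subr_le0//.
  by apply: ler_pM; lra.
- apply: (key w.1.2 w.2) => //; first by rewrite /pair_sum; lra.
  rewrite mulrC; apply: ler_pM => //.
    by rewrite ger0_norm; lra.
  by rewrite ler0_norm; lra.
- apply: (key w.1.1 w.2) => //; first by rewrite /pair_sum; lra.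
  apply: ler_pM => //.
    by rewrite ger0_norm; lra.
  by rewrite ler0_norm; lra.
- apply: (key w.1.1 w.1.2) => //; first by rewrite /pair_sum; lra.
  by apply: ler_pM => //; rewrite ger0_norm; lra.
Qed.

(** Where [pair_sum] is at most 1 the previous bound applies; elsewhere some
    product of two frequencies is at least 1/3, so the rate is bounded and the
    boundedness of psi suffices. *)
Lemma collision_factor_open_bound w : octant w ->
  `|collision_factor_open psi w| <= L + 4 * N.
Proof.
move=> ow; have [x0 y0 z0] := ow.
have [s1|s1] := leP (pair_sum w) 1.
  apply: (le_trans (collision_factor_open_small ow)).
  apply: (@le_trans _ _ (L * 1)); last by rewrite mulr1 lerDl mulr_ge0 ?profile_bound_ge0.
  by rewrite ler_wpM2l ?profile_curvature_ge0// -sqrtr1 ler_wsqrtr.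
have [h|h] := leP (w.1.1 + w.1.2) w.2.
  rewrite collision_factor_openE.
  rewrite /rate Phi_eq0// !mul0r normr0 addr_ge0 ?profile_curvature_ge0//.
  by rewrite mulr_ge0 ?profile_bound_ge0.
have w0 : 0 <= w.1.1 + w.1.2 - w.2 by rewrite subr_ge0 ltW.
rewrite collision_factor_openE normrM ger0_norm ?rate_ge0//.
apply: (@le_trans _ _ (2 * (2 * N))); last by have := profile_curvature_ge0; lra.
apply: ler_pM => //; first exact: rate_ge0.
  have [K1 K2 K3] := rate_le_pairs ow.
  have key u : 1 <= 4 * u -> (Num.sqrt u)^-1 <= 2.
    move=> u1; rewrite invf_ple ?posrE ?sqrtr_gt0//; last by lra.
    have <- : Num.sqrt (2^-1 ^+ 2) = 2^-1 :> R by rewrite sqrtr_sqr ger0_norm.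
    by rewrite ler_wsqrtr//; lra.
  have [c1|c1] := leP 1 (4 * (w.1.1 * w.1.2)); first exact: le_trans (key _ c1).
  have [c2|c2] := leP 1 (4 * (w.1.2 * w.2)); first exact: le_trans (key _ c2).
  have [c3|c3] := leP 1 (4 * (w.1.1 * w.2)); first exact: le_trans (key _ c3).
  by move: s1; rewrite /pair_sum; lra.
have /andP[? ?] := cp_bound psiP (ltW x0).
have /andP[? ?] := cp_bound psiP (ltW y0).
have /andP[? ?] := cp_bound psiP (ltW z0).
have /andP[? ?] := cp_bound psiP w0.
by rewrite /gain_loss ler_norml; apply/andP; split; lra.
Qed.

End collision.

(** * Limits of the collision factor at the boundary of the octant *)

Section collision_limit.
Variable R : realType.
Variables (psi psi1 psi2 : R -> R) (r L N : R).
Hypothesis psiP : convex_profile psi psi1 psi2 r L N.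
Implicit Types (x y z u : R) (v w : R * R * R).

Let psi_cont : continuous psi := derive_continuous (cp_derive psiP).

Section filter.
Variables (w : R * R * R) (F : set_system (R * R * R)) (FF : Filter F).
Hypothesis Fw : F `=>` nbhs w.
Hypothesis Fo : \forall v \near F, octant v.

Lemma cvg_coord1 : v.1.1 @[v --> F] --> w.1.1.
Proof.
apply: (@cvg_comp _ _ _ (fun v : R * R * R => v.1) fst _ (nbhs w.1)); last exact: cvg_fst.
apply: cvg_trans; last exact: (@cvg_fst _ _ (nbhs w.1) (nbhs w.2)).
exact: cvg_app.
Qed.

Lemma cvg_coord2 : v.1.2 @[v --> F] --> w.1.2.
Proof.
apply: (@cvg_comp _ _ _ (fun v : R * R * R => v.1) snd _ (nbhs w.1)); last exact: cvg_snd.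
apply: cvg_trans; last exact: (@cvg_fst _ _ (nbhs w.1) (nbhs w.2)).
exact: cvg_app.
Qed.

Lemma cvg_coord3 : v.2 @[v --> F] --> w.2.
Proof.
apply: cvg_trans; last exact: (@cvg_snd _ _ (nbhs w.1) (nbhs w.2)).
exact: cvg_app.
Qed.

Let cx := cvg_coord1.
Let cy := cvg_coord2.
Let cz := cvg_coord3.

Lemma cvg_gain_loss : gain_loss psi v @[v --> F] --> gain_loss psi w.
Proof.
have cp (f : R * R * R -> R) (l : R) : f @ F --> l -> psi (f v) @[v --> F] --> psi l.
  by apply: continuous_cvg; exact: psi_cont.
rewrite /gain_loss; apply: cvgB; last exact: cp.
apply: cvgB; last exact: cp.
apply: cvgD; last exact: cp.
by apply: cp; apply: cvgB => //; exact: cvgD.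
Qed.

Lemma cvg_isqrt (f : R * R * R -> R) (l : R) : 0 < l -> f @ F --> l ->
  (Num.sqrt (f v))^-1 @[v --> F] --> (Num.sqrt l)^-1.
Proof.
move=> l0 fl; apply: cvgV; first by rewrite gt_eqF// sqrtr_gt0.
by apply: continuous_cvg fl; exact: sqrt_continuous.
Qed.

Let cvg0 (h : R * R * R -> R) : h @ F --> (0:R) ->
  (\forall v \near F, `|collision_factor_open psi v| <= h v) ->
  collision_factor_open psi @ F --> (0 : R).
Proof.
move=> h0 hb; apply: (@squeeze_cvgr _ _ _ _ (\- h) h) => //.
  by near do rewrite -ler_norml.
by rewrite -oppr0; exact: cvgN.
Unshelve. all: by end_near. Qed.

Lemma cvg_collision_interior : octant w ->
  collision_factor_open psi @ F --> collision_factor_open psi w.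
Proof.
case=> x0 y0 z0.
have csq (f : R * R * R -> R) (l : R) : f @ F --> l ->
    Num.sqrt (f v) @[v --> F] --> Num.sqrt l.
  by apply: continuous_cvg; exact: sqrt_continuous.
have cmin (f g : R * R * R -> R) (l m : R) : f @ F --> l -> g @ F --> m ->
    Num.min (f v) (g v) @[v --> F] --> Num.min l m.
  move=> fl gl; rewrite minr_absE; under eq_fun do rewrite minr_absE.
  apply: cvgM; last exact: cvg_cst.
  by apply: cvgB; [exact: cvgD|apply: cvg_norm; exact: cvgB].
have cmax (f : R * R * R -> R) (l : R) : f @ F --> l ->
    Num.max (f v) 0 @[v --> F] --> Num.max l 0.
  move=> fl; rewrite maxr_absE; under eq_fun do rewrite maxr_absE.
  apply: cvgM; last exact: cvg_cst.
  by apply: cvgD; [apply: cvgD => //; exact: cvg_cst|apply: cvg_norm; apply: cvgB => //; exact: cvg_cst].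
apply: cvgM; last exact: cvg_gain_loss.
apply: cvgM; last first.
  by apply: cvg_isqrt; [rewrite !mulr_gt0|apply: cvgM => //; exact: cvgM].
rewrite /Phi; apply: (cmin); first exact: (csq).
apply: (cmin); first exact: (csq).
apply: (cmin); first exact: (csq).
by apply: (csq); apply: (cmax); apply: cvgB => //; exact: cvgD.
Qed.

Lemma cvg_collision_corner : pair_sum w = 0 ->
  collision_factor_open psi @ F --> (0 : R).
Proof.
move=> e0; apply: (cvg0 (h := fun v => L * Num.sqrt (pair_sum v))).
  have -> : 0 = L * Num.sqrt (pair_sum w) by rewrite e0 sqrtr0 mulr0.
  apply: cvgM; first exact: cvg_cst.
  apply: continuous_cvg; first exact: sqrt_continuous.
  by apply: cvgD; [apply: cvgD; exact: cvgM|exact: cvgM].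
by near=> v; apply: (collision_factor_open_small psiP); near: v.
Unshelve. all: by end_near. Qed.

Let near_lt (f g : R * R * R -> R) (l m : R) : f @ F --> l -> g @ F --> m -> l < m ->
  \forall v \near F, f v < g v.
Proof.
move=> fl gm lm; have d0 : 0 < m - l by rewrite subr_gt0.
near=> v; rewrite -subr_gt0; near: v.
exact: (cvgr_gt _ (cvgB gm fl) _ d0).
Unshelve. all: by end_near. Qed.

Lemma Phi_val (v : R * R * R) (u : R) :
  u <= v.1.1 -> u <= v.1.2 -> u <= v.2 -> u <= v.1.1 + v.1.2 - v.2 -> 0 <= u ->
  u \in [:: v.1.1; v.1.2; v.2] -> Phi v = Num.sqrt u.
Proof.
move=> ux uy uz uw u0 ue; apply/eqP; rewrite eq_le; apply/andP; split.
  move: ue; rewrite !inE /Phi !ge_min => /or3P[] /eqP ->; rewrite lexx ?orbT//.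
rewrite /Phi !le_min !ler_wsqrtr//.
by rewrite le_max uw.
Qed.

(** When the smallest frequency u is known, its square root cancels and the factor
    loses its singularity in u; this is what makes the boundary limits exist. *)
Lemma collision_factor_open_min (v : R * R * R) (u a : R) : octant v ->
  u <= v.1.1 -> u <= v.1.2 -> u <= v.2 -> u <= v.1.1 + v.1.2 - v.2 -> 0 < u ->
  u \in [:: v.1.1; v.1.2; v.2] -> v.1.1 * v.1.2 * v.2 = u * a ->
  collision_factor_open psi v = (Num.sqrt a)^-1 * gain_loss psi v.
Proof.
move=> ov ux uy uz uw u0 ue E; rewrite collision_factor_openE /rate.
rewrite (Phi_val ux uy uz uw (ltW u0) ue) E sqrtrM ?(ltW u0)// invfM mulrA.
by rewrite divff ?mul1r// gt_eqF// sqrtr_gt0.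
Qed.

Lemma cvg_collision_z : 0 < w.1.1 -> 0 < w.1.2 -> w.2 = 0 ->
  exists l : R, collision_factor_open psi @ F --> l.
Proof.
move=> x0 y0 z0.
exists ((Num.sqrt (w.1.1 * w.1.2))^-1 * gain_loss psi w).
apply: cvg_trans; last first.
  by apply: (cvgM _ cvg_gain_loss); apply: cvg_isqrt (cvgM cx cy); rewrite mulr_gt0.
apply: near_eq_cvg; near=> v.
have ov : octant v by near: v.
have [vx vy vz] := ov.
have lx : v.2 < v.1.1 by near: v; apply: near_lt cz cx _; rewrite z0.
have ly : v.2 < v.1.2 by near: v; apply: near_lt cz cy _; rewrite z0.
rewrite (@collision_factor_open_min _ v.2 (v.1.1 * v.1.2))//; try lra.
by rewrite !inE eqxx !orbT.
Unshelve. all: by end_near. Qed.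

(** As w1 tends to 0 the frequency w4 tends to (w2 - w3)_+, so there are three
    regimes: no collision if w2 < w3, cancellation of the square root of w1 if
    w2 > w3, and for w2 = w3 a bracket that tends to 0. *)
Lemma cvg_collision_x : w.1.1 = 0 -> 0 < w.1.2 -> 0 < w.2 ->
  exists l : R, collision_factor_open psi @ F --> l.
Proof.
move=> x0 y0 z0; have yz0 : 0 < w.1.2 * w.2 by rewrite mulr_gt0.
have [yz|zy|yz] := ltgtP w.1.2 w.2.
- exists 0; apply: (@cvg_trans _ (cst (0:R) @ F)); last exact: cvg_cst.
  apply: near_eq_cvg; near=> v.
  rewrite collision_factor_openE /rate Phi_eq0 ?mul0r//.
  apply: ltW; near: v; apply: near_lt (cvgD cx cy) cz _.
  by rewrite x0 add0r.
- exists ((Num.sqrt (w.1.2 * w.2))^-1 * gain_loss psi w).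
  apply: cvg_trans; last first.
    by apply: (cvgM _ cvg_gain_loss); exact: cvg_isqrt (cvgM cy cz).
  apply: near_eq_cvg; near=> v.
  have ov : octant v by near: v.
  have [vx vy vz] := ov.
  have lx : v.1.1 < v.1.2 by near: v; apply: near_lt cx cy _; rewrite x0.
  have ly : v.1.1 < v.2 by near: v; apply: near_lt cx cz _; rewrite x0.
  have lz : v.2 < v.1.2 by near: v; exact: near_lt cz cy _.
  rewrite (@collision_factor_open_min _ v.1.1 (v.1.2 * v.2))//; try lra.
  by rewrite !inE eqxx.
- exists 0; apply: (cvg0 (h := fun v => (Num.sqrt (v.1.2 * v.2))^-1 *
    (L * (`|v.1.1 - v.2| * `|v.1.2 - v.2|)))).
    have -> : 0 = (Num.sqrt (w.1.2 * w.2))^-1 *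
        (L * (`|w.1.1 - w.2| * `|w.1.2 - w.2|)) by rewrite yz subrr normr0 !mulr0.
    apply: cvgM; first exact: cvg_isqrt (cvgM cy cz).
    apply: cvgM; first exact: cvg_cst.
    by apply: cvgM; apply: cvg_norm; exact: cvgB.
  near=> v; have ov : octant v by near: v.
  have [h|h] := leP (v.1.1 + v.1.2) v.2.
    rewrite collision_factor_openE /rate Phi_eq0// !mul0r normr0.
    by rewrite mulr_ge0 ?invr_ge0 ?sqrtr_ge0// mulr_ge0 ?(profile_curvature_ge0 psiP)// mulr_ge0.
  rewrite collision_factor_openE normrM ger0_norm ?rate_ge0//.
  apply: ler_pM => //; first exact: rate_ge0.
    by have [] := rate_le_pairs ov.
  by apply: (gain_loss_bound psiP) => //; rewrite subr_ge0 ltW.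
Unshelve. all: by end_near. Qed.

End filter.
End collision_limit.

(** * The collision factor on the closed octant *)

Section collision_closure.
Variable R : realType.
Variables (psi psi1 psi2 : R -> R) (r L N : R).
Hypothesis psiP : convex_profile psi psi1 psi2 r L N.
Implicit Types (v w : R * R * R).

Definition closed_octant w : bool := [&& 0 <= w.1.1, 0 <= w.1.2 & 0 <= w.2].

Definition swap12 w : R * R * R := (w.1.2, w.1.1, w.2).

Lemma collision_factor_open_sym w :
  collision_factor_open psi (swap12 w) = collision_factor_open psi w.
Proof.
rewrite !collision_factor_openE /rate /gain_loss /Phi /swap12 /=.
rewrite (addrC w.1.2) (mulrC w.1.2) minCA.
by congr (_ * _); ring.
Qed.

(** This is where the definition by extension is shown to be meaningful: at every
    boundary point the limit exists. *)
Lemma collision_factor_cvg w : closed_octant w ->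
  collision_factor_open psi @ within (@octant R) (nbhs w) --> collision_factor psi w.
Proof.
case/and3P => x0 y0 z0.
have FF : Filter (within (@octant R) (nbhs w)) by exact: within_filter.
have Fw : within (@octant R) (nbhs w) `=>` nbhs w by exact: cvg_within.
have Fo : \forall v \near within (@octant R) (nbhs w), octant v.
  by rewrite near_withinE; apply: filterE.
rewrite /collision_factor; case: ifPn => [|wo].
  by rewrite inE; exact: (cvg_collision_interior psiP FF Fw).
suff [l Fl] : exists l : R, collision_factor_open psi @ within (@octant R) (nbhs w) --> l.
  by apply/cvg_ex; exists l.
have [xx|xx] := eqVneq w.1.1 0; have [yy|yy] := eqVneq w.1.2 0;
  have [zz|zz] := eqVneq w.2 0;
  try (by exists 0; apply: (cvg_collision_corner psiP FF Fw Fo);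
          rewrite /pair_sum ?xx ?yy ?zz; ring).
- by apply: (cvg_collision_x psiP FF Fw Fo) => //; rewrite lt0r ?yy ?zz.
- have [||||l Fl] := @cvg_collision_x _ _ _ _ _ _ _ psiP (swap12 w)
      (swap12 v @[v --> within (@octant R) (nbhs w)]) _ _ _ yy.
  + exact: (cvg_pair (cvg_pair (cvg_coord2 Fw) (cvg_coord1 Fw)) (cvg_coord3 Fw)).
  + by apply: filterS Fo => v [].
  + by rewrite lt0r xx.
  + by rewrite lt0r zz.
  exists l; apply: cvg_trans Fl.
  apply: near_eq_cvg; near=> v => /=.
  by rewrite collision_factor_open_sym.
- by apply: (cvg_collision_z psiP FF Fw Fo) => //; rewrite lt0r ?xx ?yy.
- exfalso; move: wo; rewrite notin_setE; apply; split.
  + by rewrite lt0r xx.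
  + by rewrite lt0r yy.
  + by rewrite lt0r zz.
Unshelve. all: by end_near. Qed.

(** The approach along the diagonal commutes with every permutation of the three
    frequencies, so identities and inequalities about symmetrised factors pass to
    the boundary. *)
Definition inner_shift (n : nat) w : R * R * R :=
  (w.1.1 + n.+1%:R^-1, w.1.2 + n.+1%:R^-1, w.2 + n.+1%:R^-1).

Lemma octant_shift n w : closed_octant w -> octant (inner_shift n w).
Proof.
by case/and3P => x0 y0 z0; split; rewrite /= ltr_wpDl// invr_gt0.
Qed.

Lemma collision_factor_lim w : closed_octant w ->
  collision_factor_open psi (inner_shift n w) @[n --> \oo] --> collision_factor psi w.
Proof.
move=> wo.
apply: (@cvg_comp _ _ _ (inner_shift ^~ w) _ _ (within (@octant R) (nbhs w))); last first.
  exact: collision_factor_cvg.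
have c (a : R) : a + n.+1%:R^-1 @[n --> \oo] --> a.
  rewrite -[X in _ --> X]addr0; apply: cvgD; [exact: cvg_cst|exact: cvg_harmonic].
have sw : inner_shift n w @[n --> \oo] --> w.
  by case: w {wo} => [[x y] z]; exact: (cvg_pair (cvg_pair (c x) (c y)) (c z)).
move=> P PF; have H : \forall n \near \oo, octant (inner_shift n w) -> P (inner_shift n w).
  exact: sw _ PF.
suff : \forall n \near \oo, P (inner_shift n w) by [].
by apply: filterS H => n; apply; exact: octant_shift.
Qed.

Definition cyclic_sum (f : R * R * R -> R) w : R :=
  f w + f (w.1.2, w.2, w.1.1) + f (w.2, w.1.1, w.1.2).

Lemma cyclic_sum_lim w : closed_octant w ->
  cyclic_sum (collision_factor_open psi) (inner_shift n w) @[n --> \oo]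
    --> cyclic_sum (collision_factor psi) w.
Proof.
move=> /[dup] wo /and3P[x0 y0 z0]; apply: cvgD; first apply: cvgD.
- exact: collision_factor_lim.
- exact: (@collision_factor_lim (w.1.2, w.2, w.1.1)) (introT and3P (And3 y0 z0 x0)).
- exact: (@collision_factor_lim (w.2, w.1.1, w.1.2)) (introT and3P (And3 z0 x0 y0)).
Qed.

Lemma collision_factor_bound w : closed_octant w ->
  `|collision_factor psi w| <= L + 4 * N.
Proof.
move=> wo; apply: (cvgr_to_le (cvg_norm (collision_factor_lim wo))).
apply: nearW => n; apply: (collision_factor_open_bound psiP).
exact: octant_shift.
Qed.

Let T := measurableTypeR R.

(** Extension by zero, so that the integrals over the half-line become integrals
    over the whole line. *)
Definition collision_ext (w : T * T * T) : R :=
  if closed_octant w then collision_factor psi w else 0.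

Lemma collision_ext_bound (w : T * T * T) : `|collision_ext w| <= L + 4 * N.
Proof.
rewrite /collision_ext; case: ifPn => [|_]; first exact: collision_factor_bound.
by rewrite normr0 addr_ge0 ?mulr_ge0 ?(profile_curvature_ge0 psiP) ?(profile_bound_ge0 psiP).
Qed.

Lemma measurable_collision_factor_open (f g h : T * T * T -> R) :
  measurable_fun setT f -> measurable_fun setT g -> measurable_fun setT h ->
  measurable_fun setT (fun w => collision_factor_open psi (f w, g w, h w)).
Proof.
move=> mf mg mh.
have mpsi : measurable_fun setT psi.
  by apply: continuous_measurable_fun; exact: derive_continuous (cp_derive psiP).
have msqrt : measurable_fun setT (@Num.sqrt R).
  by apply: continuous_measurable_fun; exact: sqrt_continuous.
have mw4 : measurable_fun setT (fun w => f w + g w - h w).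
  by apply: measurable_funB => //; exact: measurable_funD.
apply: measurable_funM; last first.
  apply: measurable_funB; last exact: measurableT_comp.
  apply: measurable_funB; last exact: measurableT_comp.
  by apply: measurable_funD; exact: measurableT_comp.
apply: measurable_funM.
  rewrite /Phi /=; apply: measurable_minr; first exact: measurableT_comp.
  apply: measurable_minr; first exact: measurableT_comp.
  apply: measurable_minr; first exact: measurableT_comp.
  apply: measurableT_comp => //; apply: measurable_maxr => //.
under eq_fun do rewrite -powR_inv1 ?sqrtr_ge0//.
apply: (measurableT_comp (measurable_powR _)).
apply: measurableT_comp => //; apply: measurable_funM => //.
exact: measurable_funM.
Qed.

(** The boundary values are only known as limits; measurability follows because
    they are limits of one sequence of measurable functions. *)
Lemma measurable_collision_ext : measurable_fun setT collision_ext.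
Proof.
have m1 : measurable_fun setT (fun w : T * T * T => w.1.1 : R).
  by apply: (@measurableT_comp _ _ _ _ _ _ fst _ fst).
have m2 : measurable_fun setT (fun w : T * T * T => w.1.2 : R).
  by apply: (@measurableT_comp _ _ _ _ _ _ snd _ fst).
have m3 : measurable_fun setT (fun w : T * T * T => w.2 : R) by exact: measurable_snd.
apply: (measurable_fun_cvg (h := fun n (w : T * T * T) =>
    if closed_octant w then collision_factor_open psi (inner_shift n w) else 0)).
  move=> n; apply: measurable_fun_ifT => //.
    apply: measurable_and; first exact: measurable_fun_ler.
    by apply: measurable_and; exact: measurable_fun_ler.
  by apply: measurable_collision_factor_open; exact: measurable_funD.
move=> w _; rewrite /collision_ext; case: ifPn => [|_]; last exact: cvg_cst.
exact: collision_factor_lim.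
Qed.

End collision_closure.

(** * Symmetrisation and convexity *)

Section symmetrised.
Variable R : realType.

Definition central_diff2 (f : R -> R) (c d : R) := f (c + d) + f (c - d) - 2 * f c.

Section profile.
Variables (psi psi1 psi2 : R -> R) (r L N : R).
Hypothesis psiP : convex_profile psi psi1 psi2 r L N.

Lemma central_diff2_ge0 (c d : R) : 0 <= d <= c -> 0 <= central_diff2 psi c d.
Proof.
move=> /andP[d0 dc].
have := @mixed_difference _ _ _ _ c c (c - d) (cp_derive psiP) (cp_derive2 psiP).
have -> : c + c - (c - d) = c + d by ring.
case; [lra..|] => e e0 E.
have -> : central_diff2 psi c d = psi2 e * d ^+ 2.
  by rewrite /central_diff2 mulr_natl mulr2n opprD addrA E; ring.
by rewrite mulr_ge0 ?sqr_ge0//; have /andP[] := cp_convex psiP e0.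
Qed.

Let S := cyclic_sum (collision_factor_open psi).

Lemma cyclic_sum_swap (x y z : R) : S (y, x, z) = S (x, y, z).
Proof.
rewrite /S /cyclic_sum /= -(collision_factor_open_sym psi (x, y, z)).
rewrite -(collision_factor_open_sym psi (y, z, x)).
rewrite -(collision_factor_open_sym psi (z, x, y)).
by rewrite /swap12/= addrAC.
Qed.

Lemma cyclic_sum_rot (x y z : R) : S (y, z, x) = S (x, y, z).
Proof. by rewrite /S /cyclic_sum /=; ring. Qed.

(** If w3 is the largest frequency the bracket is nonnegative by convexity.  In the
    two other terms [Phi] is the square root of the least frequency a, and their
    brackets add up to a central second difference at c with step b - a. *)
Lemma cyclic_sum_sorted (a b c : R) : 0 < a -> a <= b -> b <= c ->
  (Num.sqrt (b * c))^-1 * central_diff2 psi c (b - a) <= S (a, b, c).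
Proof.
move=> a0 ab bc; have b0 : 0 < b by exact: lt_le_trans ab.
have c0 : 0 < c by exact: lt_le_trans bc.
rewrite /S /cyclic_sum /=.
have ge0 : 0 <= collision_factor_open psi (a, b, c).
  rewrite collision_factor_openE.
  have [h|h] := leP (a + b) c; first by rewrite /rate Phi_eq0 ?mul0r.
  rewrite mulr_ge0 ?rate_ge0// /gain_loss /=.
  have [||||e e0 ->] := @mixed_difference _ _ _ _ a b c (cp_derive psiP) (cp_derive2 psiP); try lra.
  have /andP[e2 _] := cp_convex psiP e0.
  by rewrite -mulrA mulr_ge0// mulr_le0//; lra.
rewrite -[leLHS]add0r -addrA lerD//.
rewrite (@collision_factor_open_min _ _ (b, c, a) a (b * c)) //=; try lra; first last.
  by rewrite !inE eqxx !orbT.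
rewrite (@collision_factor_open_min _ _ (c, a, b) a (b * c)) //=; try lra; first last.
  by rewrite !inE eqxx !orbT.
rewrite -mulrDr ler_wpM2l ?invr_ge0 ?sqrtr_ge0// /gain_loss /central_diff2 /=.
have -> : b + c - a = c + (b - a) by ring.
have -> : c + a - b = c - (b - a) by ring.
lra.
Qed.

Lemma cyclic_sum_first_least (a b c : R) : 0 < a -> a <= b -> a <= c ->
  (Num.sqrt (b * c))^-1 * central_diff2 psi (Num.max b c) (Num.min b c - a) <= S (a, b, c).
Proof.
move=> a0 ab ac; have [bc|cb] := leP b c; first exact: cyclic_sum_sorted.
have -> : S (a, b, c) = S (a, c, b).
  by rewrite -(cyclic_sum_swap a c b) (cyclic_sum_rot b c a) (cyclic_sum_rot a b c).
rewrite (mulrC b).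
by apply: cyclic_sum_sorted => //; exact: ltW.
Qed.

Lemma cyclic_sum_open_ge0 w : octant w -> 0 <= S w.
Proof.
case: w => [[x y] z] [/= x0 y0 z0].
have key a b c : 0 < a -> a <= b -> a <= c -> 0 <= S (a, b, c).
  move=> a0 ab ac; apply: le_trans (cyclic_sum_first_least a0 ab ac).
  rewrite mulr_ge0 ?invr_ge0 ?sqrtr_ge0// central_diff2_ge0// subr_ge0 le_min ab ac/=.
  by rewrite (le_trans (y := Num.min b c))//; [lra|case: (leP b c) => //; exact: ltW].
have [xy|yx] := leP x y; have [xz|zx] := leP x z.
- exact: key.
- by rewrite -2!cyclic_sum_rot; apply: key => //; lra.
- by rewrite -cyclic_sum_rot; apply: key => //; lra.
- have [yz|zy] := leP y z.
    by rewrite -cyclic_sum_rot; apply: key => //; lra.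
  by rewrite -2!cyclic_sum_rot; apply: key => //; lra.
Qed.

(** Convex observables grow: this sign is the source of all the monotonicity used
    below. *)
Lemma cyclic_sum_ge0 (w : R * R * R) : closed_octant w ->
  0 <= cyclic_sum (collision_factor psi) w.
Proof.
move=> wo; apply: (cvgr_to_ge (cyclic_sum_lim psiP wo)).
by apply: nearW => n; apply: cyclic_sum_open_ge0; exact: octant_shift.
Qed.

Lemma cyclic_sum_octant (w : R * R * R) : octant w ->
  cyclic_sum (collision_factor psi) w = S w.
Proof.
case: w => [[x y] z] [/= x0 y0 z0].
by rewrite /S /cyclic_sum /collision_factor !mem_set.
Qed.

End profile.

(** A profile at scale r: between 1/8 and 1 on [0, r/2], and zero beyond r. *)
Definition cubic (r w : R) : R := pospart_exp 3 (1 - w / r).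

Lemma cubic_ge0 r w : 0 <= cubic r w.
Proof. by rewrite exprn_ge0// le_max lexx orbT. Qed.

Lemma cubic_le1 r w : 0 < r -> 0 <= w -> cubic r w <= 1.
Proof.
move=> r0 w0; rewrite exprn_ile1 ?le_max ?lexx ?orbT// ge_max ler01 andbT.
by rewrite gerBl divr_ge0// ltW.
Qed.

Lemma cubic_eq0 r w : 0 < r -> r <= w -> cubic r w = 0.
Proof.
move=> r0 rw; rewrite /cubic /pospart_exp max_r ?expr0n//.
by rewrite subr_le0 ler_pdivlMr// mul1r.
Qed.

Lemma cubic_half r w : 0 < r -> w <= r / 2 -> 8^-1 <= cubic r w.
Proof.
move=> r0 w0; have -> : 8^-1 = 2^-1 ^+ 3 :> R by rewrite exprVn; congr _^-1; ring.
apply: lerXn2r; rewrite ?nnegrE ?invr_ge0// ?le_max ?lexx ?orbT//.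
apply/orP; left; have : w / r <= 2^-1 by rewrite ler_pdivrMr// mulrC.
lra.
Qed.

Lemma is_derive_pospart_scale n (r w : R) :
  is_derive w 1 (fun w => pospart_exp n.+2 (1 - w / r))
    (- r^-1 * (n.+2%:R * pospart_exp n.+1 (1 - w / r))).
Proof.
have d1 : is_derive w 1 (fun w : R => 1 - w / r) (- r^-1).
  have -> : (fun w : R => 1 - w / r) = cst 1 - (r^-1 \*: id).
    by apply/funext => u; rewrite !fctE /= mulrC.
  by apply: is_derive_eq; rewrite sub0r scaler1.
have df := is_derive_pospart_exp n (1 - w / r).
apply: (is_derive_eq (@is_derive1_comp _ _ (fun w => 1 - w / r) _ _ _ df d1)).
by rewrite [LHS]mulrC.
Qed.

Lemma cubic_profile (r : R) : 0 < r ->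
  convex_profile (cubic r) (fun w => - r^-1 * (3 * pospart_exp 2 (1 - w / r)))
    (fun w => r^-1 ^+ 2 * (6 * pospart_exp 1 (1 - w / r))) r (r^-1 ^+ 2 * 6) 1.
Proof.
move=> r0; split.
- by move=> w; exact: is_derive_pospart_scale.
- move=> w.
  have := is_derive_pospart_scale 0 r w.
  move=> /(is_deriveZ (- r^-1 * 3)) d2.
  have -> : (fun w => - r^-1 * (3 * pospart_exp 2 (1 - w / r))) =
     (- r^-1 * 3) \*: (fun w : R => pospart_exp 2 (1 - w / r)).
    by apply/funext => u; rewrite mulrA.
  by apply: (is_derive_eq d2); rewrite /GRing.scale/=; ring.
- move=> w; apply: cvgM; first exact: cvg_cst.
  apply: cvgM; first exact: cvg_cst.
  apply: continuous_cvg; first exact: continuous_pospart_exp.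
  by apply: cvgB; [exact: cvg_cst|apply: cvgM; [exact: cvg_id|exact: cvg_cst]].
- move=> w w0; rewrite /pospart_exp expr1.
  have h : 0 <= Num.max (1 - w / r) 0 <= 1.
    by rewrite le_max lexx orbT ge_max ler01 gerBl divr_ge0// ltW.
  case/andP: h => h1 h2; rewrite mulr_ge0 ?sqr_ge0 ?mulr_ge0//=.
  by rewrite ler_wpM2l ?sqr_ge0// ler_piMr.
- by move=> w w0; rewrite cubic_ge0 cubic_le1.
- by move=> w; exact: cubic_eq0.
Qed.

(** The bound needs no distance between c and the edge r of the support: if the
    step crosses the edge, convexity still leaves the cube of the step.  Thus all
    the mass up to r contributes to the growth of the profile integral. *)
Lemma central_diff2_cubic (r c d : R) : 0 < r -> 0 <= d -> c <= r ->
  (d / r) ^+ 3 <= central_diff2 (cubic r) c d.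
Proof.
move=> r0 d0 cr; rewrite /central_diff2 /cubic /pospart_exp.
have -> : 1 - (c + d) / r = (1 - c / r) - d / r by rewrite mulrDl; ring.
have -> : 1 - (c - d) / r = (1 - c / r) + d / r by rewrite mulrBl; ring.
have : 0 <= 1 - c / r by rewrite subr_ge0 ler_pdivrMr// mul1r.
have : 0 <= d / r by rewrite divr_ge0// ltW.
move: (1 - c / r) (d / r) => y e e0 y0.
rewrite (max_l y0) (max_l (addr_ge0 y0 e0)).
have [ye|ey] := leP (y - e) 0.
  rewrite expr0n/= add0r -subr_ge0.
  have -> : (y + e) ^+ 3 - 2 * y ^+ 3 - e ^+ 3
    = (e - y) * y ^+ 2 + 2 * (y ^+ 2 * e) + 3 * (y * e ^+ 2) by ring.
  by rewrite !addr_ge0 ?mulr_ge0 ?sqr_ge0//; lra.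
rewrite -subr_ge0.
have -> : (y - e) ^+ 3 + (y + e) ^+ 3 - 2 * y ^+ 3 - e ^+ 3
    = 6 * ((y - e) * e ^+ 2) + 5 * e ^+ 3 by ring.
by rewrite addr_ge0 ?mulr_ge0 ?sqr_ge0 ?exprn_ge0// ltW.
Qed.

End symmetrised.

(** * Test functions of the frequency alone, up to a given time *)

Section separated_test_functions.
Variable R : realType.

Lemma is_derive_cvg (V : normedModType R) (f : V -> R) (a v : V) (l : R) :
  is_derive a v f l <->
  h^-1 *: ((f \o shift a) (h *: v) - f a) @[h --> 0^'] --> l.
Proof.
split=> [[df <-] //|fl]; split; first by apply/cvg_ex; exists l.
exact: cvg_lim.
Qed.

Lemma is_derive_separated1 (a b : R -> R) (a1 : R) (p : R * R) :
  is_derive p.1 1 a a1 ->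
  is_derive p ((1, 0) : R * R) (fun q : R * R => a q.1 * b q.2) (a1 * b p.2).
Proof.
move=> /is_derive_cvg da; apply/is_derive_cvg.
have -> : (fun h : R => h^-1 *: (((fun q : R * R => a q.1 * b q.2) \o shift p) (h *: ((1, 0) : R * R)) - a p.1 * b p.2))
  = (fun h => h^-1 *: ((a \o shift p.1) (h *: 1) - a p.1) * b p.2).
  apply/funext => h /=.
  by rewrite [X in b X](_ : _ = p.2) ?[h *: 0]mulr0 ?add0r// -mulrBl -scalerAl.
by apply: cvgM => //; exact: cvg_cst.
Qed.

Lemma is_derive_separated2 (a b : R -> R) (b1 : R) (p : R * R) :
  is_derive p.2 1 b b1 ->
  is_derive p ((0, 1) : R * R) (fun q : R * R => a q.1 * b q.2) (a p.1 * b1).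
Proof.
move=> /is_derive_cvg db; apply/is_derive_cvg.
have -> : (fun h : R => h^-1 *: (((fun q : R * R => a q.1 * b q.2) \o shift p) (h *: ((0, 1) : R * R)) - a p.1 * b p.2))
  = (fun h => a p.1 * (h^-1 *: ((b \o shift p.2) (h *: 1) - b p.2))).
  apply/funext => h /=.
  by rewrite [X in a X](_ : _ = p.1) ?[h *: 0]mulr0 ?add0r// -mulrBr scalerAr.
by apply: cvgM => //; exact: cvg_cst.
Qed.

Lemma continuous_separated (a b : R -> R) : continuous a -> continuous b ->
  continuous (fun q : R * R => a q.1 * b q.2).
Proof.
move=> ca cb p; apply: cvgM.
  by apply: continuous_cvg; [exact: ca|exact: cvg_fst].
by apply: continuous_cvg; [exact: cb|exact: cvg_snd].
Qed.

Lemma C1_quadrant_separated (a a1 b b1 : R -> R) :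
  (forall x : R, is_derive x 1 a (a1 x)) -> (forall x : R, is_derive x 1 b (b1 x)) ->
  continuous a1 -> continuous b1 ->
  C1_quadrant (fun q => a q.1 * b q.2) (fun q => a1 q.1 * b q.2)
    (fun q => a q.1 * b1 q.2).
Proof.
move=> da db ca1 cb1.
have ca := derive_continuous da; have cb := derive_continuous db.
split; try (apply: continuous_subspaceT; exact: continuous_separated).
by move=> p _ _; split; [exact: is_derive_separated1|exact: is_derive_separated2].
Qed.

Let step (T t : R) : R := 1 - pospart_exp 3 (t - T).
Let step1 (T t : R) : R := - (3 * pospart_exp 2 (t - T)).
Let step2 (T t : R) : R := - (3 * (2 * pospart_exp 1 (t - T))).

(** Equal to 1 up to time T and to 0 from time T + 1 on: compact support in time
    costs nothing in the equation up to time T. *)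
Definition cutoff (T t : R) : R := pospart_exp 3 (step T t).
Definition cutoff1 (T t : R) : R := 3 * pospart_exp 2 (step T t) * step1 T t.
Definition cutoff2 (T t : R) : R :=
  3 * (2 * pospart_exp 1 (step T t) * step1 T t) * step1 T t
  + 3 * pospart_exp 2 (step T t) * step2 T t.

Lemma is_derive_pospart_shift n (T t : R) :
  is_derive t 1 (fun t => pospart_exp n.+2 (t - T)) (n.+2%:R * pospart_exp n.+1 (t - T)).
Proof.
have d := is_derive_pospart_exp n (t - T).
apply: (is_derive_eq (@is_derive1_comp _ _ (shift (- T)) _ _ _ d (is_derive_shift t 1 _))).
exact: mulr1.
Qed.

Let dstep (T t : R) : is_derive t 1 (step T) (step1 T t).
Proof.
have d := is_derive_pospart_shift 1 T t.
by apply: (is_derive_eq (is_deriveB (is_derive_cst (1:R) t 1) d)); rewrite sub0r.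
Qed.

Let dstep1 (T t : R) : is_derive t 1 (step1 T) (step2 T t).
Proof.
have d := is_derive_pospart_shift 0 T t.
exact: (is_deriveN (is_deriveZ 3 d)).
Qed.

Lemma is_derive_cutoff (T t : R) : is_derive t 1 (cutoff T) (cutoff1 T t).
Proof.
exact: (@is_derive1_comp _ _ (step T) _ _ _ (is_derive_pospart_exp 1 _) (dstep T t)).
Qed.

Lemma is_derive_cutoff1 (T t : R) : is_derive t 1 (cutoff1 T) (cutoff2 T t).
Proof.
have d := @is_derive1_comp _ _ (step T) _ _ _ (is_derive_pospart_exp 0 _) (dstep T t).
have -> : cutoff1 T = (3 \*: (pospart_exp 2 \o step T)) * step1 T by [].
apply: (is_derive_eq (is_deriveM (is_deriveZ 3 d) (dstep1 T t))).
by rewrite addrC; congr (_ + _); exact: mulrC.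
Qed.

Let continuous_step T : continuous (step T).
Proof. exact: derive_continuous (dstep T). Qed.

Let continuous_step1 T : continuous (step1 T).
Proof. exact: derive_continuous (dstep1 T). Qed.

Lemma continuous_cutoff1 T : continuous (cutoff1 T).
Proof. exact: derive_continuous (is_derive_cutoff1 T). Qed.

Lemma continuous_cutoff2 T : continuous (cutoff2 T).
Proof.
have cs n t : pospart_exp n (step T u) @[u --> t] --> pospart_exp n (step T t).
  by apply: continuous_cvg; [exact: continuous_pospart_exp|exact: continuous_step].
move=> t; apply: cvgD.
  apply: cvgM; last exact: continuous_step1.
  apply: cvgM; first exact: cvg_cst.
  apply: cvgM; last exact: continuous_step1.
  by apply: cvgM; [exact: cvg_cst|exact: cs].
apply: cvgM; first by apply: cvgM; [exact: cvg_cst|exact: cs].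
apply: cvgN; apply: cvgM; first exact: cvg_cst.
apply: cvgM; first exact: cvg_cst.
apply: continuous_cvg; first exact: continuous_pospart_exp.
by apply: cvgB; [exact: cvg_id|exact: cvg_cst].
Qed.

Lemma cutoff_before (T t : R) : t <= T -> cutoff T t = 1 /\ cutoff1 T t = 0.
Proof.
move=> tT; rewrite /cutoff /cutoff1 /step /step1 /pospart_exp.
by rewrite (@max_r _ _ (t - T) 0) ?subr_le0// !expr0n/= subr0 (max_l ler01) expr1n !mulr0 oppr0 mulr0.
Qed.

Lemma cutoff_after (T t : R) : T + 1 <= t -> cutoff T t = 0.
Proof.
move=> tT; rewrite /cutoff /step /pospart_exp.
rewrite (@max_r _ _ _ 0) ?expr0n// subr_le0 exprn_ege1// le_max; apply/orP; left.
lra.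
Qed.

Lemma test_function_cutoff (psi psi1 psi2 : R -> R) (r L N T : R) :
  convex_profile psi psi1 psi2 r L N -> 
  test_function (fun p => cutoff T p.1 * psi p.2) (fun p => cutoff1 T p.1 * psi p.2).
Proof.
move=> psiP; split.
  exists (fun p => cutoff T p.1 * psi1 p.2), (fun p => cutoff2 T p.1 * psi p.2),
    (fun p => cutoff1 T p.1 * psi1 p.2), (fun p => cutoff1 T p.1 * psi1 p.2),
    (fun p => cutoff T p.1 * psi2 p.2).
  have c1 := derive_continuous (cp_derive2 psiP).
  split; apply: C1_quadrant_separated; try exact: is_derive_cutoff;
    try exact: is_derive_cutoff1; try exact: (cp_derive psiP);
    try exact: (cp_derive2 psiP); try exact: continuous_cutoff1;
    try exact: continuous_cutoff2; by [|exact: (cp_continuous2 psiP)].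
exists (Num.max (T + 1) r) => p _ [h|h]; move: h; rewrite gt_max => /andP[h1 h2].
  by rewrite cutoff_after ?mul0r// ltW.
by rewrite (cp_support psiP) ?mulr0// ltW.
Qed.

End separated_test_functions.

(** * The equation tested against a profile *)

Section equation.
Variable R : realType.
Local Notation T := (measurableTypeR R).
Local Notation msr := {measure set (measurableTypeR R) -> \bar R}.
Local Notation leb := (@lebesgue_measure R).
Local Notation half_line := (`[0, +oo[%classic : set R).

Definition triple_integral (mu : msr) (f : R * R * R -> R) : R :=
  \int[mu]_(w1 in half_line) \int[mu]_(w2 in half_line) \int[mu]_(w3 in half_line)
    f (w1, w2, w3).

(** A profile, cut off after time t, is a test function whose time derivative
    vanishes on [0, t]. *)
Lemma weak_solution_profile (rho : R) (g_in : msr) (g : R -> msr)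
    (psi psi1 psi2 : R -> R) (r L N t : R) :
  weak_solution_in rho g_in g -> convex_profile psi psi1 psi2 r L N -> 0 < t ->
  \int[g t]_(w in half_line) psi w - \int[g_in]_(w in half_line) psi w =
  \int[leb]_(s in `[0, t]%classic) triple_integral (g s) (collision_factor psi).
Proof.
move=> gP psiP t0.
have := ws_equation gP (test_function_cutoff t psiP) t0 => /=.
have E0 s : s <= t -> (fun w => cutoff t s * psi w) = psi.
  by move=> st; apply/funext => w; rewrite (cutoff_before st).1 mul1r.
under eq_Rintegral do rewrite (cutoff_before (lexx t)).1 mul1r.
under [X in _ - X]eq_Rintegral do rewrite (cutoff_before (ltW t0)).1 mul1r.
have z s : s <= t -> \int[g s]_(w in half_line) (cutoff1 t s * psi w) = 0.
  move=> st; rewrite /Rintegral integral0_eq// => w _.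
  by rewrite (cutoff_before st).2 mul0r.
have -> : \int[leb]_(s in `[0, t]%classic)
    \int[g s]_(w in half_line) (cutoff1 t s * psi w) = 0.
  rewrite /Rintegral integral0_eq// => s /=; rewrite in_itv/= => /andP[_ st].
  by have := z s st; rewrite /Rintegral => ->.
rewrite add0r => ->; rewrite /triple_integral.
apply: eq_Rintegral => s; rewrite inE/= in_itv/= => /andP[_ st].
by rewrite E0.
Qed.

End equation.

(** * Iterated integrals of bounded measurable functions *)

Section bounded_measurable.
Variable R : realType.

(** On a finite measure these are integrable, and the class is stable under partial
    integration, so that iterated integrals can be permuted freely. *)
Definition bmf d (T : measurableType d) (f : T -> R) :=
  measurable_fun setT f /\ exists M : R, forall x, `|f x| <= M.

Lemma bmf_comp d d' (T : measurableType d) (T' : measurableType d')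
    (g : T -> T') (f : T' -> R) :
  measurable_fun setT g -> bmf f -> bmf (fun x => f (g x)).
Proof.
by move=> mg [mf [M fM]]; split; [exact: measurableT_comp|exists M].
Qed.

Lemma bmfD d (T : measurableType d) (f g : T -> R) : bmf f -> bmf g ->
  bmf (fun x => f x + g x).
Proof.
move=> [mf [M fM]] [mg [N gN]]; split; first exact: measurable_funD.
by exists (M + N) => x; rewrite (le_trans (ler_normD _ _))// lerD.
Qed.

Lemma bmfM d (T : measurableType d) (f g : T -> R) : bmf f -> bmf g ->
  bmf (fun x => f x * g x).
Proof.
move=> [mf [M fM]] [mg [N gN]]; split; first exact: measurable_funM.
by exists (M * N) => x; rewrite normrM ler_pM.
Qed.

Lemma bmf_cst d (T : measurableType d) (c : R) : bmf (fun _ : T => c).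
Proof. by split => //; exists `|c|. Qed.

Lemma bmf_indic d (T : measurableType d) (A : set T) : measurable A ->
  bmf (\1_A : T -> R).
Proof.
move=> mA; split; first exact: measurable_indic.
by exists 1 => x; rewrite indicE; case: (_ \in _); rewrite ?normr1 ?normr0.
Qed.

Lemma bmf_integrable d (T : measurableType d)
    (mu : {finite_measure set T -> \bar R}) (f : T -> R) :
  bmf f -> mu.-integrable setT (EFin \o f).
Proof.
move=> [mf [M fM]]; apply: measurable_bounded_integrable => //.
  by rewrite -ge0_fin_numE// fin_num_measure.
exists M; split; first exact: num_real.
by move=> x Mx y _; exact: le_trans (fM y) (ltW Mx).
Qed.

Lemma bmf_Rintegral_bound d (T : measurableType d)
    (mu : {finite_measure set T -> \bar R}) (f : T -> R) (M : R) :
  measurable_fun setT f -> (forall x, `|f x| <= M) ->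
  `|\int[mu]_x f x| <= M * fine (mu setT).
Proof.
move=> mf fM; have bf : bmf f by split => //; exists M.
have bnf : bmf (fun x => `|f x|).
  by split; [exact: measurableT_comp|exists M => x; rewrite normr_id].
have le1 : `|\int[mu]_x f x| <= \int[mu]_x `|f x|.
  by apply: le_normr_Rintegral => //; exact: (bmf_integrable mu bf).
apply: (le_trans le1); rewrite -Rintegral_cst//; apply: le_Rintegral => //.
- exact: (bmf_integrable mu bnf).
- exact: (bmf_integrable mu (bmf_cst T M)).
Qed.

Section slices.
Context d1 d2 (T1 : measurableType d1) (T2 : measurableType d2).
Variable mu : {finite_measure set T2 -> \bar R}.

Lemma bmf_slice1 (f : T1 * T2 -> R) x : bmf f -> bmf (fun y => f (x, y)).
Proof. exact: bmf_comp. Qed.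

Lemma bmf_slice2 (f : T1 * T2 -> R) y : bmf f -> bmf (fun x => f (x, y)).
Proof. exact: bmf_comp. Qed.

(** Adding a constant makes the function nonnegative, so that the measurability of
    a partial integral follows from the Tonelli theorem. *)
Lemma bmf_Rintegral (f : T1 * T2 -> R) : bmf f ->
  bmf (fun x => \int[mu]_y f (x, y)).
Proof.
move=> bf; have [mf [M fM]] := bf; split; last first.
  exists (M * fine (mu setT)) => x; apply: bmf_Rintegral_bound => //.
  by have [] := bmf_slice1 x bf.
have -> : (fun x => \int[mu]_y f (x, y)) =
    (fun x => fine (\int[mu]_y (f (x, y) + M)%:E) - M * fine (mu setT)).
  apply/funext => x; rewrite -Rintegral_cst//.
  transitivity (\int[mu]_y (f (x, y) + M) - \int[mu]_(y in setT) M) => //.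
  rewrite RintegralD ?addrK//.
    exact: (bmf_integrable mu (bmf_slice1 x bf)).
  exact: (bmf_integrable mu (bmf_cst T2 M)).
apply: measurable_funB => //; apply: measurableT_comp => //.
apply: (@measurable_fun_fubini_tonelli_F _ _ T1 T2 R mu (fun p => (f p + M)%:E)).
  by apply/measurable_EFinP; exact: measurable_funD.
by move=> p; rewrite lee_fin -[M]opprK subr_ge0; have := fM p; rewrite ler_norml => /andP[].
Qed.

End slices.

Section product.
Context d1 d2 (T1 : measurableType d1) (T2 : measurableType d2).
Variables (m1 : {finite_measure set T1 -> \bar R})
  (m2 : {finite_measure set T2 -> \bar R}).

Lemma bmf_integrable_prod (f : T1 * T2 -> R) : bmf f ->
  (m1 \x m2)%E.-integrable setT (EFin \o f).
Proof.
move=> [mf [M fM]]; apply: measurable_bounded_integrable => //.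
  have := product_measure1E m1 m2 (@measurableT _ T1) (@measurableT _ T2).
  rewrite setXTT => E.
  suff : ((m1 \x m2) setT < +oo)%E by [].
  rewrite E ltey_eq; apply/orP; left.
  by rewrite fin_numM ?fin_num_measure.
exists M; split; first exact: num_real.
by move=> x Mx y _; exact: le_trans (fM y) (ltW Mx).
Qed.

Lemma Rintegral_swap (f : T1 * T2 -> R) : bmf f ->
  \int[m1]_x \int[m2]_y f (x, y) = \int[m2]_y \int[m1]_x f (x, y).
Proof.
move=> bf; have := Fubini (bmf_integrable_prod bf).
rewrite /Rintegral => F; congr fine.
transitivity (\int[m1]_x \int[m2]_y (f (x, y))%:E)%E.
  apply: eq_integral => x _; rewrite fineK//.
  exact: (integrable_fin_num measurableT (bmf_integrable m2 (bmf_slice1 x bf))).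
rewrite [LHS]F; apply: eq_integral => y _; rewrite fineK//.
exact: (integrable_fin_num measurableT (bmf_integrable m1 (bmf_slice2 y bf))).
Qed.

End product.

Section triple.
Context d (T : measurableType d) (mu : {finite_measure set T -> \bar R}).
Implicit Types f g : T * T * T -> R.

Definition total3 f : R := \int[mu]_x \int[mu]_y \int[mu]_z f (x, y, z).

Lemma bmf_Rintegral2 f : bmf f -> bmf (fun x => \int[mu]_y \int[mu]_z f (x, y, z)).
Proof. by move=> bf; apply: (@bmf_Rintegral _ _ T T mu (fun p => \int[mu]_z f (p, z))); exact: bmf_Rintegral. Qed.

Lemma total3D f g : bmf f -> bmf g ->
  total3 (fun w => f w + g w) = total3 f + total3 g.
Proof.
move=> bf bg; rewrite /total3.
transitivity (\int[mu]_x (\int[mu]_y \int[mu]_z f (x, y, z)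
    + \int[mu]_y \int[mu]_z g (x, y, z))).
  apply: eq_Rintegral => x _.
  transitivity (\int[mu]_y (\int[mu]_z f (x, y, z) + \int[mu]_z g (x, y, z))).
    apply: eq_Rintegral => y _; apply: RintegralD => //.
      exact: (bmf_integrable mu (bmf_slice1 (x, y) bf)).
    exact: (bmf_integrable mu (bmf_slice1 (x, y) bg)).
  apply: RintegralD => //.
    exact: (bmf_integrable mu (bmf_slice1 x (bmf_Rintegral mu bf))).
  exact: (bmf_integrable mu (bmf_slice1 x (bmf_Rintegral mu bg))).
apply: RintegralD => //.
  exact: (bmf_integrable mu (bmf_Rintegral2 bf)).
exact: (bmf_integrable mu (bmf_Rintegral2 bg)).
Qed.

Lemma le_total3 f g : bmf f -> bmf g -> (forall w, f w <= g w) ->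
  total3 f <= total3 g.
Proof.
move=> bf bg fg; apply: le_Rintegral => //.
- exact: (bmf_integrable mu (bmf_Rintegral2 bf)).
- exact: (bmf_integrable mu (bmf_Rintegral2 bg)).
move=> x _; apply: le_Rintegral => //.
- exact: (bmf_integrable mu (bmf_slice1 x (bmf_Rintegral mu bf))).
- exact: (bmf_integrable mu (bmf_slice1 x (bmf_Rintegral mu bg))).
move=> y _; apply: le_Rintegral => //.
- exact: (bmf_integrable mu (bmf_slice1 (x, y) bf)).
- exact: (bmf_integrable mu (bmf_slice1 (x, y) bg)).
Qed.

Lemma total3_box (c : R) (A B C : set T) :
  measurable A -> measurable B -> measurable C ->
  total3 (fun w => c * (\1_A w.1.1 * \1_B w.1.2 * \1_C w.2)) =
  c * (fine (mu A) * fine (mu B) * fine (mu C)).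
Proof.
move=> mA mB mC.
have I (D : set T) (k : R) : measurable D -> \int[mu]_x (k * \1_D x) = k * fine (mu D).
  move=> mD; rewrite RintegralZl//.
    by rewrite /Rintegral integral_indic// setIT.
  exact: (bmf_integrable mu (bmf_indic mD)).
rewrite /total3 /=.
transitivity (\int[mu]_x (c * fine (mu B) * fine (mu C) * \1_A x)); last first.
  by rewrite I//; ring.
apply: eq_Rintegral => x _.
transitivity (\int[mu]_y (c * \1_A x * fine (mu C) * \1_B y)); last first.
  by rewrite I//; ring.
apply: eq_Rintegral => y _.
transitivity (\int[mu]_z (c * \1_A x * \1_B y * \1_C z)); last first.
  by rewrite I//; ring.
by apply: eq_Rintegral => z _; ring.
Qed.

Lemma total3_bound f (M : R) : measurable_fun setT f -> (forall w, `|f w| <= M) ->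
  `|total3 f| <= M * fine (mu setT) * fine (mu setT) * fine (mu setT).
Proof.
move=> mf fM; have bf : bmf f by split => //; exists M.
apply: bmf_Rintegral_bound; first by have [] := bmf_Rintegral2 bf.
move=> x; apply: bmf_Rintegral_bound.
  by have [] := bmf_slice1 x (bmf_Rintegral mu bf).
move=> y; apply: bmf_Rintegral_bound => //.
by have [] := bmf_slice1 (x, y) bf.
Qed.

Let mrot : measurable_fun setT (fun w : T * T * T => (w.1.2, w.2, w.1.1)).
Proof.
apply: measurable_fun_pair; first apply: measurable_fun_pair.
- by apply: (@measurableT_comp _ _ _ _ _ _ snd _ fst).
- exact: measurable_snd.
- by apply: (@measurableT_comp _ _ _ _ _ _ fst _ fst).
Qed.

Lemma bmf_rot f : bmf f -> bmf (fun w => f (w.1.2, w.2, w.1.1)).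
Proof. exact: bmf_comp. Qed.

(** Two exchanges of neighbouring integrals make a cyclic permutation. *)
Lemma total3_rot f : bmf f -> total3 (fun w => f (w.1.2, w.2, w.1.1)) = total3 f.
Proof.
move=> bf; rewrite /total3 /=.
rewrite (@Rintegral_swap _ _ T T mu mu (fun p => \int[mu]_z f (p.2, z, p.1))); last first.
  apply: (@bmf_Rintegral _ _ (T * T)%type T mu (fun q : T * T * T => f (q.1.2, q.2, q.1.1))).
  exact: bmf_rot.
apply: eq_Rintegral => y _ /=.
rewrite (@Rintegral_swap _ _ T T mu mu (fun p => f (y, p.2, p.1)))//.
apply: (bmf_comp (g := fun p : T * T => (y, p.2, p.1))) bf.
apply: measurable_fun_pair => //; first exact: measurable_fun_pair.
Qed.

Lemma total3_cyclic f : bmf f ->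
  total3 (fun w => f w + f (w.1.2, w.2, w.1.1) + f (w.2, w.1.1, w.1.2)) = 3 * total3 f.
Proof.
move=> bf; have b1 := bmf_rot bf; have b2 := bmf_rot b1.
rewrite (total3D (f := fun w => f w + f (w.1.2, w.2, w.1.1))
  (g := fun w => f (w.2, w.1.1, w.1.2)) (bmfD bf b1) b2).
rewrite (total3D bf b1).
have r1 := total3_rot b1; have r := total3_rot bf.
by cbn [fst snd] in r1; rewrite r1 r; ring.
Qed.

End triple.
End bounded_measurable.

(** * Superpositions of cubic profiles *)

Section superposition.
Variable R : realType.

Lemma convex_profile0 (r : R) :
  convex_profile (fun=> 0 : R) (fun=> 0) (fun=> 0) r 0 0.
Proof.
by split => *; rewrite ?lexx//; [exact: is_derive_cst|exact: is_derive_cst|exact: cst_continuous].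
Qed.

Lemma convex_profileD (a r : R) (p p1 p2 q q1 q2 : R -> R) (L L' N N' : R) :
  0 <= a -> convex_profile p p1 p2 r L N -> convex_profile q q1 q2 r L' N' ->
  convex_profile (fun x => q x + a * p x) (fun x => q1 x + a * p1 x)
    (fun x => q2 x + a * p2 x) r (L' + a * L) (N' + a * N).
Proof.
move=> a0 P Q; split.
- by move=> x; exact: (is_deriveD (cp_derive Q x) (is_deriveZ a (cp_derive P x))).
- by move=> x; exact: (is_deriveD (cp_derive2 Q x) (is_deriveZ a (cp_derive2 P x))).
- move=> x; apply: cvgD; first exact: (cp_continuous2 Q).
  by apply: cvgM; [exact: cvg_cst|exact: (cp_continuous2 P)].
- move=> x x0; have /andP[? ?] := cp_convex P x0; have /andP[? ?] := cp_convex Q x0.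
  by rewrite addr_ge0 ?mulr_ge0//= lerD// ler_wpM2l.
- move=> x x0; have /andP[? ?] := cp_bound P x0; have /andP[? ?] := cp_bound Q x0.
  by rewrite addr_ge0 ?mulr_ge0//= lerD// ler_wpM2l.
- by move=> x rx; rewrite (cp_support P rx) (cp_support Q rx) mulr0 addr0.
Qed.

Lemma convex_profile_widen (r r' L N : R) (p p1 p2 : R -> R) : r <= r' ->
  convex_profile p p1 p2 r L N -> convex_profile p p1 p2 r' L N.
Proof.
move=> rr' [h1 h2 h3 h4 h5 h6]; split => // x rx.
by apply: h6; exact: le_trans rx.
Qed.

(** Several scales are tested at once, by a single profile: the growth rate of a
    profile integral is not known to be measurable in time, so the equations of
    separate scales could not be added afterwards. *)
Definition superposition (n : nat) (a radius : nat -> R) (w : R) : R :=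
  \sum_(k < n) a k * cubic (radius k) w.

Lemma superpositionS n (a radius : nat -> R) :
  superposition n.+1 a radius = (fun w => superposition n a radius w + a n * cubic (radius n) w).
Proof. by apply/funext => w; rewrite /superposition big_ord_recr. Qed.

Lemma superposition_profile n (a radius : nat -> R) (r : R) :
  (forall k, 0 <= a k) -> (forall k, 0 < radius k <= r) ->
  exists p1 p2 L N, convex_profile (superposition n a radius) p1 p2 r L N.
Proof.
move=> a0 radius_gt0; elim: n => [|n [p1 [p2 [L [N P]]]]].
  have -> : superposition 0 a radius = fun=> 0.
    by apply/funext => w; rewrite /superposition big_ord0.
  by do 4 eexists; exact: convex_profile0.
rewrite superpositionS; have /andP[rk0 rkr] := radius_gt0 n.
do 4 eexists; apply: convex_profileD (a0 n) _ P.
exact: convex_profile_widen rkr (cubic_profile rk0).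
Qed.

Lemma central_diff2_superposition n (a radius : nat -> R) (c d : R) :
  central_diff2 (superposition n a radius) c d = \sum_(k < n) a k * central_diff2 (cubic (radius k)) c d.
Proof.
elim: n => [|n IH]; first by rewrite /central_diff2 /superposition !big_ord0; ring.
by rewrite big_ord_recr/= -IH superpositionS /central_diff2; ring.
Qed.

(** The form of the lower bounds for the symmetrised factor, scale by scale: in the
    application the frequencies in A k lie well below those in B k. *)
Definition boxes (n : nat) (c : nat -> R) (A B : nat -> set R) (w : R * R * R) : R :=
  \sum_(k < n) c k * (\1_(A k) w.1.1 * \1_(B k) w.1.2 * \1_(B k) w.2).

(** The indicators of the boxes vanish unless the first frequency is the least; then
    the symmetrised factor is at least (b c)^(-1/2) times a central second difference
    with step at least r/8 inside the box of scale r, whence the constant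
    8^3 = 512. *)
Lemma boxes_le_cyclic_sum n (a radius : nat -> R) (r : R) (w : R * R * R) :
  (forall k, 0 <= a k) -> (forall k, 0 < radius k <= r) -> octant w ->
  boxes n (fun k => a k / (512 * radius k)) (fun k => `]0, (radius k / 8)]%classic)
    (fun k => `](radius k / 4), (radius k)]%classic) w
  <= cyclic_sum (collision_factor_open (superposition n a radius)) w.
Proof.
move=> a0 radius_gt0; case: w => [[x y] z] /= [/= x0 y0 z0].
have [p1 [p2 [L [N P]]]] := superposition_profile n a0 radius_gt0.
have [xyz|xyz] := leP x (Num.min y z); last first.
  apply: le_trans (cyclic_sum_open_ge0 P _); last by split.
  rewrite /boxes big1// => k _; have /andP[rk0 _] := radius_gt0 k.
  rewrite !indicE/=; case: (boolP (x \in _)); last by rewrite !mul0r mulr0.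
  case: (boolP (y \in _)); last by rewrite mulr0 mul0r mulr0.
  case: (boolP (z \in _)); last by rewrite !mulr0.
  rewrite !inE/= !in_itv/= => /andP[zk _] /andP[yk _] /andP[_ xk].
  by exfalso; move: xyz; rewrite gt_min => /orP[h|h]; lra.
have /andP[xy xz] : (x <= y) && (x <= z) by move: xyz; rewrite le_min.
apply: le_trans (cyclic_sum_first_least P x0 xy xz).
rewrite central_diff2_superposition mulr_sumr; apply: ler_sum => k _ /=.
have /andP[rk0 _] := radius_gt0 k.
have b0 : 0 <= central_diff2 (cubic (radius k)) (Num.max y z) (Num.min y z - x).
  apply: (central_diff2_ge0 (cubic_profile rk0)); rewrite subr_ge0 xyz/=.
  rewrite lerBlDr (@le_trans _ _ (Num.max y z))//.
    by rewrite le_max ge_min lexx.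
  by rewrite lerDl ltW.
have s0 : 0 <= (Num.sqrt (y * z))^-1 by rewrite invr_ge0 sqrtr_ge0.
rewrite !indicE/=; case: (boolP (x \in _)); last first.
  by rewrite !mul0r mulr0 ?mulr_ge0.
case: (boolP (y \in _)); last by rewrite mulr0 mul0r mulr0 ?mulr_ge0.
case: (boolP (z \in _)); last by rewrite !mulr0 ?mulr_ge0.
rewrite !inE/= !in_itv/= => /andP[zk zr] /andP[yk yr] /andP[_ xk].
rewrite !mulr1 mulrCA ler_wpM2l//.
have -> : (512 * radius k)^-1 = (radius k)^-1 * (8^-1) ^+ 3 by field; rewrite gt_eqF.
apply: ler_pM.
- by rewrite invr_ge0 ltW.
- by rewrite exprn_ge0.
- rewrite lef_pV2 ?posrE ?sqrtr_gt0 ?mulr_gt0//.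
  have -> : radius k = Num.sqrt (radius k ^+ 2) by rewrite sqrtr_sqr gtr0_norm.
  by rewrite ler_wsqrtr// expr2 ler_pM// ltW.
- apply: le_trans (central_diff2_cubic rk0 _ _); last 2 first.
  + by rewrite subr_ge0.
  + by rewrite ge_max yr zr.
  apply: lerXn2r; rewrite ?nnegrE//.
    by rewrite divr_ge0 ?subr_ge0// ltW.
  rewrite ler_pdivlMr// lerBrDr le_min; apply/andP; split; lra.
Qed.

End superposition.

(** * The total production of a profile *)

Section collision_total.
Variable R : realType.
Local Notation T := (measurableTypeR R).
Variable mu : {finite_measure set T -> \bar R}.

Section profile.
Variables (psi psi1 psi2 : R -> R) (r L N : R).
Hypothesis psiP : convex_profile psi psi1 psi2 r L N.

Lemma bmf_collision_ext : bmf (collision_ext psi : T * T * T -> R).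
Proof.
split; first exact: (measurable_collision_ext psiP).
by exists (L + 4 * N) => w; exact: (collision_ext_bound psiP).
Qed.

Lemma triple_integralE :
  triple_integral mu (collision_factor psi) = total3 mu (collision_ext psi).
Proof.
have H (F : T -> R) : \int[mu]_(x in `[0%R, +oo[%classic) F x
    = \int[mu]_x (if 0 <= x then F x else 0).
  rewrite Rintegral_mkcond; apply: eq_Rintegral => x _.
  by rewrite patchE; congr (if _ then _ else _); rewrite mem_setE in_itv/= andbT.
have z (b : bool) (F : T -> R) : \int[mu]_x (if b then F x else 0) =
    if b then \int[mu]_x F x else 0.
  by case: b => //; rewrite Rintegral_cst// mul0r.
rewrite /triple_integral /total3 H; apply: eq_Rintegral => x _.
rewrite H -z; apply: eq_Rintegral => y _.
rewrite H -2!z; apply: eq_Rintegral => t _.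
rewrite /collision_ext /closed_octant /=.
by case: (0 <= x); case: (0 <= y); case: (0 <= t).
Qed.

Lemma triple_integral_cyclic :
  3 * triple_integral mu (collision_factor psi)
  = total3 mu (cyclic_sum (collision_ext psi)).
Proof. by rewrite triple_integralE -(total3_cyclic mu bmf_collision_ext). Qed.

Lemma bmf_cyclic_sum : bmf (cyclic_sum (collision_ext psi) : T * T * T -> R).
Proof.
have b1 := bmf_rot bmf_collision_ext; have b2 := bmf_rot b1.
exact: (bmfD (bmfD bmf_collision_ext b1) b2).
Qed.

Lemma cyclic_sum_extE (w : R * R * R) :
  cyclic_sum (collision_ext psi) w =
  if closed_octant w then cyclic_sum (collision_factor psi) w else 0.
Proof.
rewrite /cyclic_sum /collision_ext /closed_octant /=.
by case: (0 <= w.1.1); case: (0 <= w.1.2); case: (0 <= w.2); rewrite ?addr0.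
Qed.

Lemma triple_integral_bound :
  `|triple_integral mu (collision_factor psi)|
    <= (L + 4 * N) * fine (mu setT) * fine (mu setT) * fine (mu setT).
Proof.
rewrite triple_integralE; apply: total3_bound.
  exact: (measurable_collision_ext psiP).
by move=> v; exact: (collision_ext_bound psiP).
Qed.

Lemma total3_0 : total3 mu (fun=> 0) = 0.
Proof. by rewrite /total3 !Rintegral_cst// !mul0r. Qed.

Lemma triple_integral_ge0 : 0 <= triple_integral mu (collision_factor psi).
Proof.
suff : 0 <= 3 * triple_integral mu (collision_factor psi) by rewrite pmulr_rge0.
rewrite triple_integral_cyclic -total3_0; apply: le_total3.
- exact: bmf_cst.
- exact: bmf_cyclic_sum.
move=> w; rewrite cyclic_sum_extE; case: ifPn => // wo.
exact: (cyclic_sum_ge0 psiP).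
Qed.

Lemma total3_boxes n (c : nat -> R) (A B : nat -> set R) :
  (forall k, measurable (A k : set T)) -> (forall k, measurable (B k : set T)) ->
  bmf (boxes n c A B : T * T * T -> R) /\
  total3 mu (boxes n c A B) =
    \sum_(k < n) c k * (fine (mu (A k)) * fine (mu (B k)) * fine (mu (B k))).
Proof.
move=> mA mB; elim: n => [|n [IHb IH]].
  have -> : boxes 0 c A B = fun=> 0 by apply/funext => w; rewrite /boxes big_ord0.
  by rewrite big_ord0 total3_0; split => //; exact: bmf_cst.
pose b := fun w : T * T * T => c n * (\1_(A n) w.1.1 * \1_(B n) w.1.2 * \1_(B n) w.2) : R.
have bb : bmf b.
  apply: bmfM; first exact: bmf_cst.
  apply: bmfM; first apply: bmfM.
  - apply: (bmf_comp (g := fun w : T * T * T => w.1.1)); last exact: bmf_indic.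
    exact: (measurableT_comp measurable_fst measurable_fst).
  - apply: (bmf_comp (g := fun w : T * T * T => w.1.2)); last exact: bmf_indic.
    exact: (measurableT_comp measurable_snd measurable_fst).
  - apply: (bmf_comp (g := fun w : T * T * T => w.2)); last exact: bmf_indic.
    exact: measurable_snd.
have -> : boxes n.+1 c A B = fun w => boxes n c A B w + b w.
  by apply/funext => w; rewrite /boxes big_ord_recr.
split; first exact: bmfD.
rewrite (total3D mu IHb bb) IH big_ord_recr; congr (_ + _).
exact: total3_box.
Qed.

Lemma triple_integral_ge_boxes n (c : nat -> R) (A B : nat -> set R) :
  (forall k, 0 <= c k) ->
  (forall k, measurable (A k : set T)) -> (forall k, measurable (B k : set T)) ->
  (forall k x, A k x -> 0 < x) -> (forall k x, B k x -> 0 < x) ->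
  (forall w, octant w -> boxes n c A B w <= cyclic_sum (collision_factor_open psi) w) ->
  \sum_(k < n) c k * (fine (mu (A k)) * fine (mu (B k)) * fine (mu (B k)))
  <= 3 * triple_integral mu (collision_factor psi).
Proof.
move=> c0 mA mB A0 B0 bS; have [bb <-] := total3_boxes n c mA mB.
rewrite triple_integral_cyclic; apply: le_total3 => //; first exact: bmf_cyclic_sum.
move=> w; rewrite cyclic_sum_extE.
have [wo|wo] := pselect (octant w).
  have -> : closed_octant w by case: wo => /ltW h1 /ltW h2 /ltW h3; apply/and3P.
  by rewrite (cyclic_sum_octant psi wo); exact: bS.
rewrite [X in X <= _](_ : _ = 0).
  by case: ifPn => // ?; exact: (cyclic_sum_ge0 psiP).
rewrite /boxes big1// => k _; rewrite !indicE.
case: (boolP (w.1.1 \in _)); last by rewrite !mul0r mulr0.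
case: (boolP (w.1.2 \in _)); last by rewrite mulr0 mul0r mulr0.
case: (boolP (w.2 \in _)); last by rewrite !mulr0.
rewrite !inE => h3 h2 h1; exfalso; apply: wo; split; [exact: A0 h1|exact: B0 h2|exact: B0 h3].
Qed.

End profile.

(** Production at scale r: at least the mass near the origin times the square of
    the mass at the scale r, divided by r. *)
Lemma triple_integral_superposition_ge n (a radius : nat -> R) (r : R) :
  (forall k, 0 <= a k) -> (forall k, 0 < radius k <= r) ->
  \sum_(k < n) a k / (512 * radius k) * (fine (mu `]0, (radius k / 8)]%classic)
     * fine (mu `](radius k / 4), (radius k)]%classic) * fine (mu `](radius k / 4), (radius k)]%classic))
  <= 3 * triple_integral mu (collision_factor (superposition n a radius)).
Proof.
move=> a0 radius_gt0; have [p1 [p2 [L [N P]]]] := superposition_profile n a0 radius_gt0.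
apply: (triple_integral_ge_boxes (n := n) (c := fun k => a k / (512 * radius k))
  (A := fun k => `]0, (radius k / 8)]%classic) (B := fun k => `](radius k / 4), (radius k)]%classic) P).
- move=> k; have /andP[r0 _] := radius_gt0 k.
  by apply: divr_ge0; [exact: a0|apply: mulr_ge0; [exact: ler0n|exact: ltW]].
- by move=> k; exact: measurable_itv.
- by move=> k; exact: measurable_itv.
- by move=> k x /=; rewrite in_itv/= => /andP[].
- move=> k x /=; have /andP[r0 _] := radius_gt0 k.
  by rewrite in_itv/= => /andP[+ _]; apply: lt_trans; rewrite divr_gt0.
- by move=> w wo; exact: boxes_le_cyclic_sum a0 radius_gt0 wo.
Qed.

End collision_total.

(** * Integrals in time of functions of unknown measurability *)

Section unmeasured_integrals.
Variable R : realType.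

(** The integral of a nonnegative function is a supremum over the simple functions
    below it, hence monotone without measurability. *)
Lemma ge0_le_integral_unmeasured d (T : measurableType d)
    (mu : {measure set T -> \bar R}) (f1 f2 : T -> \bar R) :
  (forall x, 0 <= f1 x)%E -> (forall x, f1 x <= f2 x)%E ->
  (\int[mu]_x f1 x <= \int[mu]_x f2 x)%E.
Proof.
move=> f10 f12; have f20 x : (0 <= f2 x)%E by exact: le_trans (f12 x).
rewrite !ge0_integralTE//; apply: le_ereal_sup => _ [h hf1 <-].
by exists h => // x; exact: le_trans (f12 x).
Qed.

Local Notation leb := (@lebesgue_measure R).

Lemma integral_cst_itv (c a b : R) (i j : bool) : a <= b ->
  (\int[leb]_x ((fun=> c%:E) \_ [set` Interval (BSide i a) (BSide j b)]) x = (c * (b - a))%:E)%E.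
Proof.
move=> ab; rewrite -integral_mkcond integral_cst//= lebesgue_measure_itv/= lte_fin.
have [ba|ba] := ltP a b; first by rewrite -EFinB -EFinM.
by have -> : a = b; [apply/eqP; rewrite eq_le ab ba|rewrite subrr mulr0 mule0].
Qed.

Variables (f : R -> R) (C t : R).
Hypothesis t0 : 0 <= t.
Hypothesis f0C : forall s, 0 <= s <= t -> 0 <= f s <= C.

Let F (s : R) : measurableTypeR R -> \bar R :=
  (fun x => (f x)%:E) \_ `[0, s]%classic.

Let F_ge0 s x : s <= t -> (0 <= F s x)%E.
Proof.
move=> st; rewrite /F patchE; case: ifPn => //.
rewrite inE/= in_itv/= => /andP[x0 xs]; rewrite lee_fin.
by have /andP[] : 0 <= f x <= C by apply: f0C; rewrite x0 (le_trans xs).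
Qed.

Let RF s : \int[leb]_(x in `[0, s]%classic) f x = fine (\int[leb]_x F s x)%E.
Proof. by rewrite /Rintegral integral_mkcond. Qed.

Let F_fin s : 0 <= s <= t -> (\int[leb]_x F s x)%E \is a fin_num.
Proof.
move=> /andP[s0 st]; rewrite ge0_fin_numE; last first.
  by apply: integral_ge0 => x _; exact: F_ge0.
have H : (\int[leb]_x ((fun=> C%:E) \_ `[0%R, s]%classic) x)%E = (C * s)%:E.
  by rewrite integral_cst_itv// subr0.
apply: (@le_lt_trans _ _ (C * s)%:E); last exact: ltry.
rewrite -H; apply: ge0_le_integral_unmeasured => x; first exact: F_ge0.
rewrite /F !patchE; case: ifPn => // ; rewrite inE/= in_itv/= => /andP[x0 xs].
by rewrite lee_fin; have /andP[] : 0 <= f x <= C by apply: f0C; rewrite x0 (le_trans xs).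
Qed.

Lemma le_Rintegral_itv_unmeasured s : 0 <= s <= t ->
  \int[leb]_(x in `[0, s]%classic) f x <= \int[leb]_(x in `[0, t]%classic) f x.
Proof.
move=> /andP[s0 st]; rewrite !RF fine_le ?F_fin ?s0 ?t0 ?lexx//.
apply: ge0_le_integral_unmeasured => x; first exact: F_ge0.
rewrite /F !patchE; case: ifPn => [|_].
  rewrite inE/= in_itv/= => /andP[x0 xs].
  by rewrite mem_set//= in_itv/= x0 (le_trans xs).
by have := F_ge0 x (lexx t); rewrite /F patchE.
Qed.

Lemma Rintegral_itv_ge_cst s c : 0 <= s <= t -> 0 <= c ->
  (forall x, s < x <= t -> c <= f x) ->
  c * (t - s) <= \int[leb]_(x in `[0, t]%classic) f x.
Proof.
move=> /andP[s0 st] c0 cf; rewrite RF -lee_fin fineK ?F_fin ?t0 ?lexx//.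
have H : (\int[leb]_x ((fun=> c%:E) \_ `]s, t]%classic) x)%E = (c * (t - s))%:E.
  exact: integral_cst_itv.
rewrite -H; apply: ge0_le_integral_unmeasured => x.
  by rewrite patchE; case: ifPn.
rewrite patchE; case: ifPn => [|_]; last exact: F_ge0.
rewrite inE/= in_itv/= => /andP[sx xt].
by rewrite /F patchE mem_set/= ?in_itv/= ?xt ?(le_trans s0 (ltW sx))// lee_fin cf// sx.
Qed.

End unmeasured_integrals.

(** * Finiteness of the mass *)

Section finite_mass.
Variable R : realType.
Local Notation T := (measurableTypeR R).
Local Notation msr := {measure set T -> \bar R}.

Lemma geometric_sum_le (q : R) n : 0 <= q < 1 -> \sum_(k < n) q ^+ k <= (1 - q)^-1.
Proof.
move=> /andP[q0 q1]; have d0 : 0 < 1 - q by rewrite subr_gt0.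
rewrite -[leRHS]mul1r ler_pdivlMr// mulrC.
have <- : 1 - q ^+ n = (1 - q) * \sum_(i < n) q ^+ i.
  by rewrite -[in LHS](expr1n _ n) subrXX; congr (_ * _); apply: eq_bigr => i _; rewrite expr1n mul1r.
by rewrite gerBl exprn_ge0.
Qed.

(** Cauchy-Schwarz with the geometric weights (2/3)^k, whose sum is at most 3, in
    the form of the inequality between x^2/u and its tangent lines in x. *)
Lemma weighted_square n (x : nat -> R) :
  (\sum_(k < n) x k) ^+ 2 <= 3 * \sum_(k < n) (3 / 2) ^+ k * x k ^+ 2.
Proof.
set Y := \sum_(k < n) x k.
have H : \sum_(k < n) (2 * (Y / 3) * x k - (Y / 3) ^+ 2 * (2 / 3) ^+ k) <=
   \sum_(k < n) (3 / 2) ^+ k * x k ^+ 2.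
  apply: ler_sum => k _; rewrite -subr_ge0.
  have p0 : 0 < (3 / 2) ^+ k :> R by rewrite exprn_gt0// divr_gt0.
  have -> : (2 / 3) ^+ k = ((3 / 2) ^+ k)^-1 :> R by rewrite -exprVn invf_div.
  set p := (3 / 2) ^+ k in p0 *.
  have -> : p * x k ^+ 2 - (2 * (Y / 3) * x k - (Y / 3) ^+ 2 / p)
     = (p * x k - Y / 3) ^+ 2 / p by field; rewrite gt_eqF.
  by rewrite divr_ge0 ?sqr_ge0// ltW.
rewrite sumrB -!mulr_sumr -/Y in H.
have g : \sum_(i < n) (2 / 3) ^+ i <= 3 :> R.
  have e3 : (1 - 2 / 3)^-1 = 3 :> R by field.
  rewrite -[leRHS]e3.
  by apply: geometric_sum_le; apply/andP; split; lra.
have : (Y / 3) ^+ 2 * \sum_(i < n) (2 / 3) ^+ i <= (Y / 3) ^+ 2 * 3.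
  by rewrite ler_wpM2l ?sqr_ge0.
have -> : (Y / 3) ^+ 2 * 3 = Y ^+ 2 / 3 by field.
have : 2 * (Y / 3) * Y = 2 * (Y ^+ 2 / 3) by field.
lra.
Qed.

Lemma finite_measure_pack (mu : msr) : (mu setT < +oo)%E ->
  exists nu : {finite_measure set T -> \bar R}, (nu : msr) = mu.
Proof.
move=> fmu.
exists (mfrestr measurableT fmu); apply: eq_measure.
by apply/funext => E; rewrite /= /mfrestr /mrestr setIT.
Qed.

(** The norm bounds the mass of the dyadic interval ending at r = 2^k by a multiple
    of r^(rho + 1), and these powers are summable because rho < -1. *)
Lemma in_M_finite (rho : R) (m : msr) : rho < -1 -> in_M rho m -> (m setT < +oo)%E.
Proof.
move=> rho1 [m0 _ mN].
have term_ge0 (r : R) : 1 < r ->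
    (0 <= ((1 + r) `^ rho)^-1%:E * (r^-1%:E * m `[(r / 2)%R, r]%classic))%E.
  move=> r1; apply: mule_ge0; first by rewrite lee_fin invr_ge0 powR_ge0.
  apply: mule_ge0 => //; rewrite lee_fin invr_ge0.
  by rewrite ltW// (lt_trans ltr01).
pose E := [set ((1 + r) `^ rho)^-1%:E * (r^-1%:E * m `[(r / 2)%R, r]%classic)
             | r in [set r : R | (1 < r)%R]]%E.
have sup_ge (r : R) : 1 < r ->
    (((1 + r) `^ rho)^-1%:E * (r^-1%:E * m `[(r / 2)%R, r]%classic) <= ereal_sup E)%E.
  by move=> r1; apply: ereal_sup_ubound; exists r.
have sup0 : (0 <= ereal_sup E)%E.
  have r2 : 1 < 2 :> R by rewrite ltr1n.
  exact: le_trans (term_ge0 2 r2) (sup_ge 2 r2).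
have N0 : (0 <= Mnorm rho m)%E by rewrite adde_ge0.
have [S SE] : exists S : R, Mnorm rho m = S%:E.
  by exists (fine (Mnorm rho m)); rewrite fineK// ge0_fin_numE.
have m01 : (m `[0%R, 1%R]%classic <= S%:E)%E by rewrite -SE leeDr.
have mr (r : R) : 1 < r -> (m `[(r / 2)%R, r]%classic <= (S * r `^ (rho + 1))%:E)%E.
  move=> r1; have r0 : 0 < r by exact: lt_trans r1.
  have : (((1 + r) `^ rho)^-1%:E * (r^-1%:E * m `[(r / 2)%R, r]%classic) <= S%:E)%E.
    by apply: le_trans (sup_ge r r1) _; rewrite -SE leeDl.
  rewrite lee_pdivrMl ?powR_gt0 ?addr_gt0// lee_pdivrMl// => /le_trans; apply.
  rewrite -!EFinM lee_fin.
  have -> : r `^ (rho + 1) = r `^ rho * r.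
    by rewrite powRD ?powRr1 ?(ltW r0)// (gt_eqF r0) implybT.
  rewrite mulrC mulrA ler_wpM2r ?(ltW r0)//.
  have S0 : 0 <= S by rewrite -lee_fin -SE.
  rewrite mulrC ler_wpM2l// -[rho]opprK powRN [leRHS]powRN.
  rewrite lef_pV2 ?posrE ?powR_gt0 ?addr_gt0//.
  by rewrite ge0_ler_powR ?nnegrE ?oppr_ge0 ?lerDr//; lra.
set q := 2 `^ (rho + 1) : R.
have q0 : 0 <= q by exact: powR_ge0.
have q1 : q < 1.
  rewrite /q -[rho + 1]opprK powRN invf_lt1 ?powR_gt0//.
  have d0 : 0 < - (rho + 1) by lra.
  have := @gt0_ltr_powR R _ d0 1 2; rewrite powR1; apply; rewrite ?nnegrE//.
  by rewrite ltr1n.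
have S0 : 0 <= S by rewrite -lee_fin -SE.
(* the half-lines up to 2^n exhaust the line, and each adds one dyadic interval *)
pose F n := `]-oo, ((2:R) ^+ n)]%classic : set T.
have mF n : measurable (F n) by exact: measurable_itv.
have bound n : (m (F n) <= (S + \sum_(k < n) S * q ^+ k.+1)%:E)%E.
  elim: n => [|n IH].
    rewrite big_ord0 addr0; apply: le_trans m01.
    have -> : F 0%N = `]-oo, 0%R[%classic `|` `[0%R, 1%R]%classic.
      rewrite /F expr0; apply/seteqP; split => x /=; rewrite !in_itv/=.
        by move=> x1; case: (ltP x 0) => x0; [left|right].
      by case=> [/ltW /le_trans|/andP[]//]; apply.
    apply: le_trans (measureU2 _ _ _) _; [exact: measurable_itv..|].
    by rewrite [X in (X + _)%E](m0 : m `]-oo, 0[%classic = 0%E) add0e.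
  have -> : F n.+1 = F n `|` `[(2 ^+ n.+1 / 2)%R, ((2:R) ^+ n.+1)%R]%classic.
    have -> : 2 ^+ n.+1 / 2 = 2 ^+ n :> R by rewrite exprSr mulfK.
    have nn : 2 ^+ n <= 2 ^+ n.+1 :> R by rewrite ler_eXn2l// ltr1n.
    apply/seteqP; split => x /=; rewrite !in_itv/=.
      by move=> x1; case: (leP x (2 ^+ n)) => x0; [left|right; rewrite (ltW x0)].
    by case=> [/le_trans|/andP[]//]; apply.
  apply: le_trans (measureU2 _ _ _) _; [exact: mF|exact: measurable_itv|].
  rewrite big_ord_recr/= addrA EFinD leeD//.
  apply: le_trans (mr _ _) _; first by rewrite exprn_egt1// ltr1n.
  rewrite lee_fin ler_wpM2l// le_eqVlt; apply/orP; left; apply/eqP.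
  by rewrite -(powR_mulrn n.+1 (ler0n R 2)) powRAC powR_mulrn.
apply: (@le_lt_trans _ _ (S + S * (1 - q)^-1)%:E); last exact: ltry.
have FT : \bigcup_n F n = setT.
  apply/seteqP; split => // x _; exists (Num.bound `|x|) => //.
  rewrite /F /= in_itv/=; apply: le_trans (ler_norm x) _.
  apply: ltW; apply: lt_le_trans (archi_boundP (normr_ge0 x)) _.
  by rewrite -natrX ler_nat ltnW// ltn_expl.
have ndF : nondecreasing_seq F.
  move=> i j ij; apply/subsetPset => x; rewrite /F /= !in_itv/= => /le_trans; apply.
  by rewrite ler_weXn2l// ler1n.
have := @nondecreasing_cvg_mu _ _ _ m F mF _ ndF.
rewrite FT => /(_ measurableT) cv.
rewrite -(cvg_lim _ cv)//; apply: lime_le; first by apply/cvg_ex; exists (m setT).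
apply: nearW => n /=; apply: le_trans (bound n) _; rewrite lee_fin lerD2l.
rewrite -mulr_sumr ler_wpM2l//.
apply: le_trans (geometric_sum_le n _); last by rewrite q0.
by apply: ler_sum => k _; rewrite exprS ler_piMl ?exprn_ge0// ltW.
Qed.

End finite_mass.

(** * The initial mass near the origin *)

Section initial_mass.
Variable R : realType.
Local Notation T := (measurableTypeR R).
Local Notation msr := {measure set T -> \bar R}.

(** On (0, x) the density A w^(-1/2) is at least its value at x. *)
Lemma g_initial_ge (A B x : R) (A_gt0 : 0 < A) (g0 : msr) : 0 < x -> x <= B ->
  ((A * Num.sqrt x)%:E <= g_initial A_gt0 B g0 `]0%R, x[%classic)%E.
Proof.
move=> x0 xB.
apply: (@le_trans _ _ (mrestr (RJ_measure A_gt0) (measurable_itv `]0, B[) `]0%R, x[%classic)); last first.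
  pose m2 : msr := mrestr (meas_min (RJ_measure A_gt0) g0) (measurable_itv `]B, +oo[).
  have -> : g_initial A_gt0 B g0 `]0%R, x[%classic =
      (mrestr (RJ_measure A_gt0) (measurable_itv `]0%R, B[) `]0%R, x[%classic
       + m2 `]0%R, x[%classic)%E.
    exact: measure_addE.
  by rewrite leeDl.
rewrite /mrestr.
have -> : `]0, x[%classic `&` `]0, B[%classic = `]0, x[%classic :> set R.
  apply/seteqP; split => y /=; rewrite !in_itv/=; first by case.
  by move=> /andP[y0 yx]; rewrite y0 yx (lt_le_trans yx).
rewrite /RJ_measure /= /mdensity.
apply: (@le_trans _ _ (\int[@lebesgue_measure R]_(y in `]0%R, x[%classic) (A * (Num.sqrt x)^-1)%:E)%E).
  rewrite integral_cst//= lebesgue_measure_itv/= lte_fin x0 -EFinB -EFinM lee_fin subr0.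
  rewrite -mulrA ler_wpM2l ?(ltW A_gt0)//.
  by rewrite -{3}(sqr_sqrtr (ltW x0)) expr2 mulrA mulVf ?mul1r// gt_eqF// sqrtr_gt0.
apply: ge0_le_integral => //=.
- by move=> y _; rewrite lee_fin mulr_ge0 ?(ltW A_gt0)// invr_ge0 sqrtr_ge0.
- apply/measurable_EFinP/measurable_funTS; exact: measurable_funM.
- move=> y; rewrite in_itv/= => /andP[y0 yx]; rewrite lee_fin ler_wpM2l ?(ltW A_gt0)//.
  rewrite powRN powR12_sqrt ?(ltW y0)// lef_pV2 ?posrE ?sqrtr_gt0//.
  by rewrite ler_wsqrtr// ltW.
Qed.

End initial_mass.

(** * Masses of intervals and integrals of profiles *)

Section profile_integral.
Variable R : realType.
Local Notation T := (measurableTypeR R).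
Local Notation half_line := (`[0, +oo[%classic : set R).
Variable mu : {finite_measure set T -> \bar R}.

Definition profile_integral (psi : R -> R) : R := \int[mu]_(w in half_line) psi w.

Let mH : measurable (half_line : set T).
Proof. exact: measurable_itv. Qed.

Lemma integrable_indicM (E : set T) (c : R) : measurable E ->
  mu.-integrable half_line (EFin \o (fun w : T => c * \1_E w)).
Proof.
move=> mE.
exact: (integrableS measurableT mH (@subsetT _ _)
  (bmf_integrable mu (bmfM (bmf_cst T c) (bmf_indic R mE)))).
Qed.

Lemma Rintegral_indicM (E : set T) (c : R) : measurable E -> E `<=` half_line ->
  \int[mu]_(w in half_line) (c * \1_E w) = c * fine (mu E).
Proof.
move=> mE EH; rewrite RintegralZl//.
- by rewrite /Rintegral integral_indic// setIidl.
- have := integrable_indicM 1 mE; apply: eq_integrable => //.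
  by move=> x _ /=; rewrite mul1r.
Qed.

Section bounds.
Variables (psi psi1 psi2 : R -> R) (r L N : R).
Hypothesis psiP : convex_profile psi psi1 psi2 r L N.

Lemma profile_integrable : mu.-integrable half_line (EFin \o (psi : T -> R)).
Proof.
apply: measurable_bounded_integrable => //.
- apply: (@le_lt_trans _ _ (mu setT)); last by rewrite -ge0_fin_numE// fin_num_measure.
  by apply: le_measure; rewrite ?inE.
- apply: measurable_funTS; apply: continuous_measurable_fun.
  exact: derive_continuous (cp_derive psiP).
exists N; split; first exact: num_real.
move=> M NM w /=; rewrite in_itv/= andbT => w0.
have /andP[p0 pN] := cp_bound psiP w0.
by rewrite ger0_norm// (le_trans pN)// ltW.
Qed.

Lemma profile_integral_ge (E : set T) (c : R) : measurable E -> E `<=` half_line ->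
  (forall w, E w -> c <= psi w) -> c * fine (mu E) <= profile_integral psi.
Proof.
move=> mE EH Ec; rewrite -Rintegral_indicM//; apply: (le_Rintegral mH).
- exact: integrable_indicM.
- exact: profile_integrable.
move=> w; rewrite /= in_itv/= andbT => w0; rewrite indicE.
have /andP[p0 _] := cp_bound psiP w0.
by case: (boolP (w \in E)); rewrite ?mulr1 ?mulr0// inE => /Ec.
Qed.

Lemma profile_integral_le (c : R) : (forall w, 0 <= w <= r -> psi w <= c) ->
  profile_integral psi <= c * fine (mu `[0, r]%classic).
Proof.
move=> pc; rewrite -Rintegral_indicM; last 2 first.
- exact: measurable_itv.
- by move=> w /=; rewrite !in_itv/= andbT => /andP[].
apply: (le_Rintegral mH).
- exact: profile_integrable.
- by apply: integrable_indicM; exact: measurable_itv.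
move=> w; rewrite /= in_itv/= andbT => w0; rewrite indicE mem_setE in_itv/= w0/=.
have [wr|rw] := leP w r; first by rewrite mulr1 pc ?w0.
by rewrite mulr0 (cp_support psiP)// ltW.
Qed.

Lemma profile_integral_ge0 : 0 <= profile_integral psi.
Proof.
apply: Rintegral_ge0 => w /=; rewrite in_itv/= andbT => w0.
by have /andP[] := cp_bound psiP w0.
Qed.

End bounds.

Lemma le_fine_measure (E F : set T) : measurable E -> measurable F -> E `<=` F ->
  fine (mu E) <= fine (mu F).
Proof.
move=> mE mF EF; rewrite fine_le ?fin_num_measure//.
by apply: le_measure => //; rewrite inE.
Qed.

Lemma fine_measure_ge0 (E : set T) : 0 <= fine (mu E).
Proof. exact: fine_ge0. Qed.

Lemma fine_measure_split (r s : R) : 0 <= s <= r ->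
  fine (mu `[0, r]%classic) = fine (mu `[0, s]%classic) + fine (mu `]s, r]%classic).
Proof.
move=> /andP[s0 sr]; rewrite -fineD ?fin_num_measure//; last first.
rewrite -measureU//; first congr (fine (mu _)).
- apply/seteqP; split => x /=; rewrite !in_itv/=.
    by move=> /andP[x0 xr]; case: (leP x s) => xs; [left; rewrite x0|right].
  by case=> /andP[h1 h2]; [rewrite h1 (le_trans h2)|rewrite h2 (le_trans s0 (ltW h1))].
- apply/seteqP; split => // x [] /=; rewrite !in_itv/= => /andP[_ xs] /andP[sx _].
  by move: (lt_le_trans sx xs); rewrite ltxx.
Qed.

(** The shells are those of the scales r / 4^k, written with the bounds that the
    boxes have at each scale. *)
Lemma fine_measure_dyadic (r : R) n : 0 < r ->
  fine (mu `[0, r]%classic) = fine (mu `[0, (r / 4 ^+ n)]%classic) +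
    \sum_(k < n) fine (mu `](r / 4 ^+ k / 4), (r / 4 ^+ k)]%classic).
Proof.
move=> r0; elim: n => [|n IH]; first by rewrite big_ord0 addr0 expr0 divr1.
rewrite big_ord_recr/= IH (@fine_measure_split (r / 4 ^+ n) (r / 4 ^+ n.+1)).
  by rewrite exprSr invfM mulrA; ring.
have p0 : 0 < 4 ^+ n :> R by rewrite exprn_gt0.
rewrite divr_ge0 ?(ltW r0) ?exprn_ge0//= ler_pM2l// lef_pV2 ?posrE ?exprn_gt0//.
by rewrite ler_weXn2l// ler1n.
Qed.

Lemma small_interval (e : R) : mu [set 0%R] = 0%E -> 0 < e ->
  exists2 s : R, 0 < s & fine (mu `[0, s]%classic) < e.
Proof.
move=> mu0 e0.
pose F n := `[0%R, (n.+1%:R^-1 : R)]%classic : set T.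
have mF n : measurable (F n) by exact: measurable_itv.
have F0 : \bigcap_n F n = [set 0%R].
  apply/seteqP; split => [x Fx|x /= -> n _]; last by rewrite /F/= in_itv/= lexx invr_ge0 ler0n.
  have /andP[x0 _] : 0 <= x <= 0.+1%:R^-1 by have := Fx 0%N Logic.I; rewrite /F/= in_itv.
  apply/eqP; rewrite eq_le x0 andbT leNgt; apply/negP => xp.
  have /andP[_] : 0 <= x <= (Num.bound x^-1).+1%:R^-1.
    by have := Fx (Num.bound x^-1) Logic.I; rewrite /F/= in_itv.
  rewrite leNgt => /negP; apply; rewrite invf_plt ?posrE//.
  apply: lt_trans (archi_boundP _) _; first by rewrite invr_ge0.
  by rewrite ltr_nat.
have niF : nonincreasing_seq F.
  move=> i j ij; apply/subsetPset => x; rewrite /F/= !in_itv/= => /andP[-> /=].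
  by move=> /le_trans; apply; rewrite lef_pV2 ?posrE ?ltr0n// ler_nat.
have muF : mu (\bigcap_n F n) = 0%E by rewrite F0; exact: mu0.
have mcap : measurable (\bigcap_n F n) by exact: bigcapT_measurable.
have fin0 : (mu (F 0%N) < +oo)%E by rewrite -ge0_fin_numE// fin_num_measure.
have cv : mu (F n) @[n --> \oo] --> 0%E.
  by rewrite -muF; exact: nonincreasing_cvg_mu fin0 mF mcap niF.
have [n _ /(_ n (leqnn n)) /= h] := cvgr_lt _ (fine_cvg cv) _ e0.
by exists n.+1%:R^-1; rewrite ?invr_gt0.
Qed.

End profile_integral.

(** * Growth of the profile integrals and condensation *)

Section evolution.
Variable R : realType.
Local Notation T := (measurableTypeR R).
Local Notation leb := (@lebesgue_measure R).
Variables (G : R -> {finite_measure set T -> \bar R})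
  (Gin : {finite_measure set T -> \bar R}) (A B M : R).
Hypotheses (A_gt0 : 0 < A) (B_gt0 : 0 < B).
Hypothesis G_equation : forall (psi psi1 psi2 : R -> R) (r L N t : R),
  convex_profile psi psi1 psi2 r L N -> 0 < t ->
  profile_integral (G t) psi - profile_integral Gin psi =
  \int[leb]_(s in `[0, t]%classic) triple_integral (G s) (collision_factor psi).
Hypothesis G_mass : forall s : R, 0 <= s -> fine (G s setT) <= M.
Hypothesis Gin_ge : forall x : R, 0 < x <= B -> A * Num.sqrt x <= fine (Gin `]0, x[%classic).

Let B4_gt0 : 0 < B / 4.
Proof. by rewrite divr_gt0. Qed.

Let B4_le : B / 4 <= B.
Proof. by move: B_gt0 => B0; rewrite ler_pdivrMr// ler_peMr ?(ltW B0)// ler1n. Qed.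

Let B4_half : B / 4 <= B / 2.
Proof. by move: B_gt0 => B0; rewrite ler_pM2l// lef_pV2 ?posrE// ler_nat. Qed.

Section profile.
Variables (psi psi1 psi2 : R -> R) (r L N : R).
Hypothesis psiP : convex_profile psi psi1 psi2 r L N.

Lemma production_bounds (s : R) : 0 <= s ->
  0 <= triple_integral (G s) (collision_factor psi) <= (L + 4 * N) * M * M * M.
Proof.
move=> s0; rewrite (triple_integral_ge0 _ psiP)/=.
apply: le_trans (ler_norm _) _.
apply: le_trans (triple_integral_bound _ psiP) _.
have m0 := fine_measure_ge0 (G s) setT; have mM := G_mass s0.
have LN : 0 <= L + 4 * N by rewrite addr_ge0 ?mulr_ge0 ?(profile_curvature_ge0 psiP) ?(profile_bound_ge0 psiP).
by do 3 (apply: ler_pM; rewrite ?mulr_ge0//).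
Qed.

Let pb (t s : R) : 0 <= s <= t ->
  0 <= triple_integral (G s) (collision_factor psi) <= (L + 4 * N) * M * M * M.
Proof. by move=> /andP[s0 _]; exact: production_bounds. Qed.

Lemma profile_integral_in (t : R) : 0 < t ->
  profile_integral Gin psi <= profile_integral (G t) psi.
Proof.
move=> t0; rewrite -subr_ge0 (G_equation psiP t0).
by apply: Rintegral_ge0 => s /=; rewrite in_itv/= => /pb /andP[].
Qed.

(** The production is nonnegative, and so its integral up to s is at most its
    integral up to t. *)
Lemma profile_integral_nd (s t : R) : 0 < s -> s <= t ->
  profile_integral (G s) psi <= profile_integral (G t) psi.
Proof.
move=> s0 st; have t0 : 0 < t by exact: lt_le_trans st.
rewrite -(lerD2r (- profile_integral Gin psi)) !(G_equation psiP)//.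
by apply: (le_Rintegral_itv_unmeasured (ltW t0) (@pb t)); rewrite (ltW s0).
Qed.

Lemma profile_integral_growth (s t c : R) : 0 <= s -> s < t -> 0 <= c ->
  (forall u, s < u <= t -> c <= triple_integral (G u) (collision_factor psi)) ->
  c * (t - s) <= profile_integral (G t) psi.
Proof.
move=> s0 st c0 cu; have t0 : 0 < t by exact: le_lt_trans st.
apply: (@le_trans _ _ (profile_integral (G t) psi - profile_integral Gin psi)); last first.
  by rewrite gerBl; exact: (profile_integral_ge0 Gin psiP).
rewrite (G_equation psiP t0).
by apply: (Rintegral_itv_ge_cst (ltW t0) (@pb t)) => //; rewrite s0 ltW.
Qed.

End profile.

Let segment_half_line (x : R) : `[0, x]%classic `<=` `[0, +oo[%classic.
Proof. by move=> w /=; rewrite !in_itv/= andbT => /andP[]. Qed.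

Lemma cubic_in_ge (x r : R) : 0 < x -> x <= B -> x <= r / 2 ->
  A * Num.sqrt x / 8 <= profile_integral Gin (cubic r).
Proof.
move=> x0 xB xr; have r0 : 0 < r by lra.
apply: (@le_trans _ _ (8^-1 * fine (Gin `]0, x[%classic))).
  by rewrite mulrC ler_pM2l ?invr_gt0//; apply: Gin_ge; rewrite x0.
apply: (profile_integral_ge Gin (cubic_profile r0)) => //.
- by move=> w /=; rewrite !in_itv/= andbT => /andP[/ltW].
- move=> w /=; rewrite in_itv/= => /andP[_ wx]; apply: cubic_half => //.
  by rewrite (le_trans (ltW wx)).
Qed.

Lemma cubic_le_mass (mu : {finite_measure set T -> \bar R}) (r : R) : 0 < r ->
  profile_integral mu (cubic r) <= fine (mu `[0, r]%classic).
Proof.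
move=> r0; rewrite -[leRHS]mul1r.
apply: (profile_integral_le mu (cubic_profile r0)) => w /andP[w0 _].
exact: cubic_le1.
Qed.

(** Concentration near the origin is irreversible: the cubic profile of scale 2x
    lies between 1/8 on [0, x] and 1 on [0, 2x], and its integral increases. *)
Lemma mass_le_later (s t x : R) : 0 < s -> s <= t -> 0 < x ->
  fine (G s `[0, x]%classic) <= 8 * fine (G t `[0, (2 * x)]%classic).
Proof.
move=> s0 st x0; have x20 : 0 < 2 * x by rewrite mulr_gt0.
rewrite -ler_pdivrMl//.
apply: le_trans (cubic_le_mass (G t) x20).
apply: le_trans (profile_integral_nd (cubic_profile x20) s0 st).
apply: (profile_integral_ge (G s) (cubic_profile x20)) => //.
move=> w /=; rewrite in_itv/= => /andP[_ wx]; apply: cubic_half => //.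
by rewrite mulrC mulKf.
Qed.

Section contradiction.
Variable t : R.
Hypothesis t_large : 2 ^+ 30 * A ^- 2 < t.
Hypothesis no_condensate : G t [set 0%R] = 0%E.

Let t_gt0 : 0 < t.
Proof. by apply: le_lt_trans t_large; rewrite mulr_ge0 ?exprn_ge0// invr_ge0 exprn_ge0// ltW. Qed.

(** Later mass on [0, x] tends to 0 with x, and it controls the earlier mass at 0. *)
Lemma no_condensate_before (s : R) : 0 < s -> s <= t -> fine (G s [set 0%R]) = 0.
Proof.
move=> s0 st; apply/eqP; rewrite eq_le fine_measure_ge0 andbT.
apply/ler_addgt0Pl => e e0; rewrite addr0.
have [x x0 xe] := small_interval no_condensate (divr_gt0 e0 (ltr0n R 8)).
have x20 : 0 < x / 2 by rewrite divr_gt0.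
apply: (@le_trans _ _ (fine (G s `[0, (x / 2)]%classic))).
  apply: le_fine_measure; [exact: measurable_set1|exact: measurable_itv|].
  by move=> w /= ->; rewrite in_itv/= lexx ltW.
apply: le_trans (mass_le_later s0 st x20) _.
have -> : 2 * (x / 2) = x by rewrite mulrC divfK.
by rewrite -ler_pdivlMl// mulrC ltW.
Qed.

(** The initial bound A x^(1/2) on the mass near the origin persists, because the
    integral of a cubic profile increases; and none of this mass sits at 0. *)
Lemma small_scale_mass (s r : R) : 0 < s -> s <= t -> 0 < r -> r <= B ->
  A * Num.sqrt r / 32 <= fine (G s `]0, (r / 8)]%classic).
Proof.
move=> s0 st r0 rB; have r80 : 0 < r / 8 by rewrite divr_gt0.
have -> : fine (G s `]0, (r / 8)]%classic) = fine (G s `[0, (r / 8)]%classic).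
  rewrite (@fine_measure_split _ _ _ 0); last by rewrite lexx ltW.
  by rewrite set_itv1 no_condensate_before// add0r.
apply: le_trans (cubic_le_mass (G s) r80).
apply: le_trans (profile_integral_in (cubic_profile r80) s0).
have -> : A * Num.sqrt r / 32 = A * Num.sqrt (r / 16) / 8.
  have -> : r / 16 = r * (4^-1 ^+ 2) by field.
  by rewrite sqrtrM ?(ltW r0)// sqrtr_sqr ger0_norm//; field.
by apply: cubic_in_ge; lra.
Qed.

(** A lower bound for the initial value of X: the contribution of the largest scale. *)
Let X0 := A * Num.sqrt B / 16.

Let X0_gt0 : 0 < X0.
Proof. by rewrite divr_gt0// mulr_gt0// sqrtr_gt0. Qed.

(** The weights add up to at most 4, which bounds the superposition; but the weight
    times the factor 2^k that the scale B / 4^k brings to the production increases,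
    so that the production controls the square of the whole mass. *)
Let a (k : nat) : R := (3 / 4) ^+ k.
Let radius (k : nat) : R := B / 4 ^+ k.

Let a_ge0 k : 0 <= a k. Proof. by rewrite exprn_ge0. Qed.

Let radius_gt0 k : 0 < radius k <= B.
Proof.
rewrite divr_gt0 ?exprn_gt0//= ler_pdivrMr ?exprn_gt0// ler_peMr ?(ltW B_gt0)//.
by rewrite exprn_ege1// ler1n.
Qed.

(** Uniformly in time before t, the mass below some scale is a small fraction of
    X0.  Stopping at that scale makes the superposition finite. *)
Lemma negligible_scale_exists : exists n, (0 < n)%N /\
  forall s : R, 0 < s -> s <= t -> fine (G s `[0, radius n]%classic) <= X0 / 8.
Proof.
(* 64 = 8 * 8: one factor 8 is lost in the comparison with the mass at time t *)
have [x x0 xe] := small_interval no_condensate (divr_gt0 X0_gt0 (ltr0n R 64)).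
exists (Num.bound (2 * B / x)).+1; split => // s s0 st.
set n := _.+1.
have /andP[r0 _] := radius_gt0 n.
apply: le_trans (mass_le_later s0 st r0) _.
have : fine (G t `[0, (2 * radius n)]%classic) <= fine (G t `[0, x]%classic).
  apply: le_fine_measure; [exact: measurable_itv|exact: measurable_itv|].
  move=> w /=; rewrite !in_itv/= => /andP[-> /=] /le_trans; apply.
  rewrite /radius mulrA ler_pdivrMr ?exprn_gt0// [x * _]mulrC -ler_pdivrMr//.
  have h0 : 0 <= 2 * B / x by apply: divr_ge0; [apply: mulr_ge0|]; rewrite // ltW.
  apply: ltW; apply: lt_le_trans (archi_boundP h0) _.
  rewrite -natrX ler_nat (leq_trans (leqnSn _))// ltnW// ltn_expl//.
lra.
Qed.

Let mH : measurable (`[0, +oo[%classic : set T).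
Proof. exact: measurable_itv. Qed.

(** The constant of the differential inequality X' >= c X^2. *)
Let c := A * Num.sqrt B / (2 ^+ 24 * B).

(** Let X be the integral of the superposition.  Since X grows at least like the
    solution of X' = c X^2 and starts from X0, it doubles from 2^m X0 within
    time 2 / (c 2^m X0), and all these times add up to 4 / (c X0) = 2^30 / A^2.
    By then X would exceed every bound, although it is at most four times the
    total mass. *)
Lemma condensation_contradiction : False.
Proof.
have [n [n0 cut]] := negligible_scale_exists.
pose phi := superposition n a radius.
have [p1 [p2 [L [N P]]]] := superposition_profile n a_ge0 radius_gt0.
pose X s := profile_integral (G s) phi.
pose x s (k : nat) := fine (G s `](radius k / 4), (radius k)]%classic).
have X0_le (s : R) : 0 < s -> X0 <= X s.
  move=> s0; apply: le_trans (profile_integral_in P s0).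
  apply: (@le_trans _ _ (profile_integral Gin (cubic B))).
    have -> : X0 = A * Num.sqrt (B / 4) / 8.
      have -> : B / 4 = B * (2^-1 ^+ 2) by field.
      by rewrite sqrtrM ?(ltW B_gt0)// sqrtr_sqr ger0_norm// /X0; field.
    by apply: cubic_in_ge.
  apply: (le_Rintegral mH).
  - exact: (profile_integrable Gin (cubic_profile B_gt0)).
  - exact: (profile_integrable Gin P).
  move=> w _; rewrite /superposition; case: n n0 {cut phi P X} => // m _.
  rewrite big_ord_recl /a /radius expr0 mul1r expr0 divr1 lerDl sumr_ge0// => k _.
  by apply: mulr_ge0; [exact: a_ge0|exact: cubic_ge0].
have X_le (s : R) : X s <= 4 * fine (G s `[0, B]%classic).
  apply: (profile_integral_le (G s) P) => w /andP[w0 _].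
  apply: (@le_trans _ _ (\sum_(k < n) (3 / 4) ^+ k)).
    apply: ler_sum => k _; rewrite ler_piMr// cubic_le1//.
    by have /andP[] := radius_gt0 k.
  have e4 : (1 - 3 / 4)^-1 = 4 :> R by field.
  rewrite -[leRHS]e4.
  by apply: geometric_sum_le; apply/andP; split; lra.
(* the mass below the last scale is at most X0 / 8, and X is at least X0 *)
have Y_ge (s : R) : 0 < s -> s <= t -> X s / 8 <= \sum_(k < n) x s k.
  move=> s0 st; have h1 := X_le s; have h2 := cut s s0 st; have h3 := X0_le s s0.
  have h4 := fine_measure_dyadic (G s) n B_gt0.
  rewrite h4 in h1.
  have {h1}h1 : X s <= 4 * (fine (G s `[0, radius n]%classic) + \sum_(k < n) x s k) := h1.
  by lra.
have prod (s : R) : 0 < s -> s <= t ->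
    c * X s ^+ 2 <= triple_integral (G s) (collision_factor phi).
  move=> s0 st; have Xs0 : 0 <= X s by rewrite (le_trans (ltW X0_gt0))// X0_le.
  have b := triple_integral_superposition_ge (G s) n a_ge0 radius_gt0.
  have sB : 0 < Num.sqrt B by rewrite sqrtr_gt0.
  (* per scale: 512 from the production and 32 from the mass near the origin make 2^14 *)
  have q : A * Num.sqrt B / (2 ^+ 14 * B) * \sum_(k < n) (3 / 2) ^+ k * x s k ^+ 2
      <= 3 * triple_integral (G s) (collision_factor phi).
    apply: le_trans b; rewrite mulr_sumr; apply: ler_sum => k _.
    have /andP[rk0 rkB] := radius_gt0 k.
    have m := small_scale_mass s0 st rk0 rkB.
    rewrite -/(x s k); set y := x s k.
    apply: (@le_trans _ _ (a k / (512 * radius k) * (A * Num.sqrt (radius k) / 32 * y * y))).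
      have sr : Num.sqrt (radius k) = Num.sqrt B / 2 ^+ k.
        rewrite /radius sqrtrM ?(ltW B_gt0)// -exprVn.
        have -> : 4^-1 ^+ k = (2^-1 ^+ k) ^+ 2 :> R.
          by rewrite -exprM mulnC exprM; congr (_ ^+ k); field.
        by rewrite sqrtr_sqr ger0_norm ?exprn_ge0// exprVn.
      rewrite sr /a /radius.
      have -> : (4 : R) ^+ k = 2 ^+ k * 2 ^+ k by rewrite -exprMn; congr (_ ^+ k); ring.
      have -> : (3 / 4) ^+ k = (3 / 2) ^+ k / 2 ^+ k :> R.
        by rewrite -exprVn -exprMn; congr (_ ^+ k); field.
      have k0 : (2 : R) ^+ k != 0 by rewrite expf_neq0.
      have B0 : B != 0 by rewrite gt_eqF.
      rewrite le_eqVlt; apply/orP; left; apply/eqP.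
      move: ((3 / 2) ^+ k) (2 ^+ k) k0 => u v v0.
      by field; rewrite v0 B0.
    apply: ler_wpM2l.
      by apply: divr_ge0; [exact: a_ge0|apply: mulr_ge0; [exact: ler0n|exact: ltW]].
    by do 2 (apply: ler_wpM2r; first exact: fine_measure_ge0).
  have w := weighted_square n (x s).
  have Y0 : (X s / 8) ^+ 2 <= (\sum_(k < n) x s k) ^+ 2.
    apply: lerXn2r; rewrite ?nnegrE ?divr_ge0//; last exact: Y_ge.
    by apply: le_trans (Y_ge s s0 st); rewrite divr_ge0.
  have w' := le_trans Y0 w.
  have cK : c = A * Num.sqrt B / (2 ^+ 14 * B) / 1024.
    rewrite /c (_ : 2 ^+ 24 = 2 ^+ 14 * 1024 :> R); last by ring.
    have B0 : B != 0 by rewrite gt_eqF.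
    have k0 : (2 : R) ^+ 14 != 0 by rewrite expf_neq0.
    by move: (2 ^+ 14) k0 => v v0; field; rewrite v0 B0.
  have K0 : 0 <= A * Num.sqrt B / (2 ^+ 14 * B).
    by apply: divr_ge0; apply: mulr_ge0; rewrite ?sqrtr_ge0 ?exprn_ge0// ltW.
  have I0 : 0 <= triple_integral (G s) (collision_factor phi).
    by have /andP[] := production_bounds P (ltW s0).
  (* 8^2 * 3 * 3 = 576 is below 2^10, which is what the constant c gives away *)
  have w2 := ler_wpM2l K0 w'.
  rewrite {}cK; move: q w2 I0.
  move: (A * _ / _) (triple_integral _ _) (\sum_(k < n) _) => K I S q w2 I0.
  have -> : K / 1024 * X s ^+ 2 = (K * (X s / 8) ^+ 2) / 16 by field.
  lra.
have c_gt0 : 0 < c.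
  by apply: divr_gt0; apply: mulr_gt0 => //; rewrite ?sqrtr_gt0 ?exprn_gt0.
pose D := (c * X0)^-1.
have D_gt0 : 0 < D by rewrite invr_gt0 mulr_gt0.
have DE : 4 * D = 2 ^+ 30 * A ^- 2.
  have sB : Num.sqrt B != 0 by rewrite gt_eqF ?sqrtr_gt0.
  have A0 : A != 0 by rewrite gt_eqF.
  have k0 : (2 : R) ^+ 24 != 0 by rewrite expf_neq0.
  rewrite /D /c /X0 (_ : 2 ^+ 30 = 2 ^+ 24 * 64 :> R); last by ring.
  rewrite -[in 2 ^+ 24 * B](sqr_sqrtr (ltW B_gt0)).
  by move: (2 ^+ 24) (Num.sqrt B) k0 sB => v b v0 b0; field; rewrite v0 b0 A0.
(* the time by which X has doubled m times *)
pose tt (m : nat) := 4 * D * (1 - (2 ^+ m)^-1).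
have tt_ge0 m : 0 <= tt m.
  rewrite mulr_ge0 ?mulr_ge0 ?(ltW D_gt0)// subr_ge0 invf_le1 ?exprn_gt0//.
  by rewrite exprn_ege1// ler1n.
have doubling m : forall s, tt m < s -> s <= t -> 2 ^+ m * X0 <= X s.
  elim: m => [|m IH] s ts st.
    rewrite expr0 mul1r; apply: X0_le.
    by move: ts; rewrite /tt expr0 invr1 subrr mulr0.
  have p0 : 0 < 2 ^+ m :> R by rewrite exprn_gt0.
  have tt_step : tt m.+1 - tt m = 2 * D / 2 ^+ m.
    by rewrite /tt exprS; field; rewrite gt_eqF.
  have d0 : 0 < 2 * D / 2 ^+ m by rewrite divr_gt0// mulr_gt0.
  have tms : tt m < s by apply: le_lt_trans ts; rewrite -subr_ge0 tt_step ltW.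
  apply: (@le_trans _ _ (c * (2 ^+ m * X0) ^+ 2 * (s - tt m))); last first.
    apply: (profile_integral_growth P (tt_ge0 m) tms).
      by rewrite mulr_ge0 ?sqr_ge0// ltW.
    move=> u /andP[tu us]; have u0 : 0 < u by exact: le_lt_trans tu.
    have ut : u <= t by exact: le_trans st.
    apply: le_trans (prod u u0 ut); rewrite ler_pM2l//.
    apply: lerXn2r; rewrite ?nnegrE; last exact: IH.
      by rewrite mulr_ge0 ?(ltW p0)// ltW.
    by apply: le_trans (X0_le u u0); exact: ltW.
  apply: (@le_trans _ _ (c * (2 ^+ m * X0) ^+ 2 * (2 * D / 2 ^+ m))).
    rewrite le_eqVlt; apply/orP; left; apply/eqP; rewrite /D exprS.
    by field; rewrite !gt_eqF.
  rewrite ler_wpM2l//; first by rewrite mulr_ge0 ?sqr_ge0// ltW.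
  by rewrite -tt_step lerB// ltW.
have tt_lt m : tt m < t.
  apply: le_lt_trans t_large; rewrite -DE; apply: ler_piMr.
    by apply: mulr_ge0 => //; exact: ltW.
  by rewrite gerBl invr_ge0 exprn_ge0.
have X_bounded : X t <= 4 * M.
  apply: le_trans (X_le t) _; rewrite ler_pM2l//.
  apply: le_trans (G_mass (ltW t_gt0)).
  by apply: le_fine_measure => //; exact: measurable_itv.
have M0 : 0 <= 4 * M by apply: le_trans X_bounded; apply: le_trans (X0_le t t_gt0); exact: ltW.
have h0 : 0 <= 4 * M / X0 by rewrite divr_ge0// ltW.
have := archi_boundP h0; set m := Num.bound _ => mM.
have := doubling m t (tt_lt m) (lexx t).
apply/negP; rewrite -ltNge; apply: le_lt_trans X_bounded _.
rewrite -ltr_pdivrMr//; apply: lt_le_trans mM _.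
by rewrite -natrX ler_nat ltnW// ltn_expl.
Qed.

End contradiction.
End evolution.

(** * The theorem *)

Unset Implicit Arguments.

Theorem theorem1p1 (R : realType) :
  exists C : R, 0 < C /\
    forall (A B rho : R) (A_gt0 : 0 < A), 0 < B -> rho < -1 ->
    forall g0 : {measure set (measurableTypeR R) -> \bar R}, in_M rho g0 ->
    forall g : R -> {measure set (measurableTypeR R) -> \bar R},
      weak_solution (g_initial A_gt0 B g0) g ->
      forall t : R, C * A ^- 2 < t -> (0 < g t [set 0%R])%E.
Proof.
exists (2 ^+ 30); split; first by rewrite exprn_gt0.
move=> A B _ A_gt0 B_gt0 _ g0 _ g [rho rho1 gP] t t_large.
rewrite lt0e measure_ge0 andbT; apply/eqP => gt0.
have [Gin GinE] := finite_measure_pack (in_M_finite rho1 (ws_initial_in_M gP)).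
have /choice[G GE] (s : R) : exists nu : {finite_measure set (measurableTypeR R) -> \bar R},
    0 <= s -> (nu : {measure set (measurableTypeR R) -> \bar R}) = g s.
  have [s0|s0] := leP 0 s; last by exists Gin.
  have [nu nuE] := finite_measure_pack (in_M_finite rho1 (ws_in_M gP s0)).
  by exists nu.
have t_gt0 : 0 < t.
  apply: le_lt_trans t_large.
  by rewrite mulr_ge0 ?exprn_ge0// invr_ge0 exprn_ge0// ltW.
apply: (@condensation_contradiction R G Gin A B
  (Num.max (fine (G 0 setT)) (fine (Gin setT)))) t_large _ => //.
- move=> psi psi1 psi2 r L N s psiP s0.
  rewrite /profile_integral (GE s (ltW s0)) GinE (weak_solution_profile gP psiP s0).
  apply: eq_Rintegral => u; rewrite inE/= in_itv/= => /andP[u0 _].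
  by rewrite (GE u u0).
- move=> s; rewrite le_eqVlt => /predU1P[<-|s0]; rewrite le_max ?lexx//.
  apply/orP; right.
  have -> : fine (G s setT) = fine (Gin `[0%R, +oo[%classic).
    have GsE E : G s E = g s E by rewrite -(GE s (ltW s0)).
    have GinEE E : Gin E = g_initial A_gt0 B g0 E by rewrite -GinE.
    rewrite GsE GinEE -(ws_mass gP s0).
    have [m0 _ _] := ws_in_M gP (ltW s0).
    rewrite -[g s `[0, +oo[%classic]add0e -[X in (X + _)%E](m0 : g s `]-oo, 0%R[%classic = 0%E).
    rewrite -measureU.
    - congr (fine (g s _)); apply/seteqP; split => // w _ /=.
      by rewrite !in_itv/= andbT; case: (ltP w 0) => w0; [left|right].
    - exact: measurable_itv.
    - exact: measurable_itv.
    - apply/seteqP; split => // w [] /=; rewrite !in_itv/= andbT => w0 w0'.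
      by move: (lt_le_trans w0 w0'); rewrite ltxx.
  by apply: le_fine_measure => //; exact: measurable_itv.
- move=> x /andP[x0 xB]; have GinEE E : Gin E = g_initial A_gt0 B g0 E by rewrite -GinE.
  rewrite -lee_fin fineK ?fin_num_measure// GinEE.
  exact: g_initial_ge.
- by rewrite -(GE t (ltW t_gt0)) in gt0.
Qed.
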